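(* Let $\sigma < -2$ and $p > -1-\sigma$, and set \[ a = \frac{\sigma+2}{1-p} \in (0,1), \qquad c_a = \big(a(1-a)\big)^{1/(p-1)}, \qquad u_a(x) = c_a x^a . \] Consider positive solutions $u \in C^2(0,+\infty)$ of $u''(x) + x^\sigma u(x)^p = 0$ for $x>0$. Then: (1) if $a > 1/2$, there is such a solution $u$ with $\lim_{x\searrow0} u(x)/u_a(x) = 0$ and $\lim_{x\nearrow+\infty} u(x)/u_a(x) = 1$; (2) if $a = 1/2$, there is such a solution $u$ with $\lim_{x\searrow0} u(x)/u_a(x) = 0$ and $\lim_{x\nearrow+\infty} u(x)/u_a(x) = 0$; (3) if $a < 1/2$, there is such a solution $u$ with $\lim_{x\searrow0} u(x)/u_a(x) = 1$ and $\lim_{x\nearrow+\infty} u(x)/u_a(x) = 0$. Moreover, in each case the solution with the stated asymptotic behaviour is unique up to the scaling transformation $u \mapsto u_\lambda$, $u_\lambda(x) = \lambda^{-a} u(\lambda x)$, $\lambda>0$.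
   Context: The function $u_a$ is itself a positive solution of the same equation on $(0,+\infty)$. *)

(* Defs.v *)
From Stdlib Require Import Reals.
From Coquelicot Require Import Coquelicot.
Open Scope R_scope.

Definition expo_a (sigma p : R) : R := (sigma + 2) / (1 - p).

Definition c_a (sigma p : R) : R :=
  let a := expo_a sigma p in Rpower (a * (1 - a)) (1 / (p - 1)).

Definition u_a (sigma p : R) (x : R) : R :=
  c_a sigma p * Rpower x (expo_a sigma p).

Definition pos_C2_sol (sigma p : R) (u : R -> R) : Prop :=
  (forall x, 0 < x -> 0 < u x) /\
  exists u1 u2 : R -> R,
    forall x, 0 < x ->
      is_derive u x (u1 x) /\ is_derive u1 x (u2 x) /\ continuous u2 x /\
      u2 x + Rpower x sigma * Rpower (u x) p = 0.

Definition asym (sigma p : R) (u : R -> R) (l0 linf : R) : Prop :=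
  filterlim (fun x => u x / u_a sigma p x) (at_right 0) (locally l0) /\
  filterlim (fun x => u x / u_a sigma p x) (Rbar_locally p_infty) (locally linf).

Definition unique_up_to_scaling (a : R) (P : (R -> R) -> Prop) : Prop :=
  forall u v, P u -> P v ->
    exists lam, 0 < lam /\ forall x, 0 < x -> v x = Rpower lam (- a) * u (lam * x).

Definition exists_unique_up_to_scaling (a : R) (P : (R -> R) -> Prop) : Prop :=
  (exists u, P u) /\ unique_up_to_scaling a P.

(* Main.v *)
Require Import Defs.
From Stdlib Require Import Reals Lra Lia.
From Coquelicot Require Import Coquelicot.
Open Scope R_scope.

(** In the Emden-Fowler variable [y(t) = e^(-a t) u(e^t)] the equation becomes
    autonomous, [y'' = (1 - 2a) y' + a(1 - a) y - y^p]; scaling of [u] becomes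
    translation in [t], [u / u_a] becomes [y / c_a], and time reversal exchanges
    [a] and [1 - a], so that only [a >= 1/2] and orbits leaving the saddle
    [y = 0] matter.

    Existence: with [h = u / x] and [r = x^m / m], [m = sigma + p + 1 > 0], the
    problem [u(0) = 0], [u'(0) = 1] is a regular Volterra equation on
    [r >= 0], solved globally by contraction in an exponentially weighted norm
    because a solution satisfies [h <= 1]. For [a >= 1/2] the energy
    [y'^2/2 - a(1-a) y^2/2 + y^(p+1)/(p+1)] is nonincreasing and tends to 0 at
    [-oo], which forces positivity; for [a > 1/2] adding a small multiple of
    [y' (y^p - a(1-a) y)] gives a strict Lyapunov function, and Barbalat's
    argument yields [y -> c_a]. For [a = 1/2] the orbit is explicit.

    Uniqueness: comparison of [u] with [x^s], [s] close to 1, shows that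
    [u'(0+)] is finite; after scaling, two solutions have equal slope at 0, and a
    Gronwall estimate shows that they coincide. *)

(** * Positive-part powers and elementary calculus *)

(** Two obstacles shape the proof. At the origin [x^sigma] is singular; only the combination
    [x^sigma u^p = x^(m-1) h^p] is integrable there. Since [dr = x^(m-1) dx], the variable [r]
    absorbs the whole singularity: [du'/dr = - h^p] is regular even when [m < 1]. Moreover
    [m = (p - 1)(1 - a)], so that [m > 0] expresses [a < 1]. The prescribed asymptotics control the
    size of [u] at 0 but say nothing about [u']. The slope has to be recovered from [u = o(x^a)] and
    from the concavity of positive solutions before a Gronwall estimate can start at [t = -oo].
    Accordingly each orbit is read in two ways: as [(h, Q) = (u / x, u')] near the saddle, where the
    forcing [e^(m t) h^p] is small, and as [(y, z)] with [z = y'] in the global analysis, where the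
    system is autonomous. Powers are extended by 0 to the negative half-line, where [Rpower] has no
    meaningful value, so that the equation and its energy can be written before positivity of the
    orbit is known; for exponents above 1 the extension is still C^1. *)

Definition ppow (q x : R) : R :=
  if Rlt_dec 0 x then Rpower x q else 0.

Lemma ppow_pos (q x : R) : 0 < x -> ppow q x = Rpower x q.
Proof. intros H; unfold ppow; destruct (Rlt_dec 0 x); lra. Qed.

Lemma ppow_nonpos (q x : R) : x <= 0 -> ppow q x = 0.
Proof. intros H; unfold ppow; destruct (Rlt_dec 0 x); lra. Qed.

Lemma Rpower_gt0 (x q : R) : 0 < Rpower x q.
Proof. apply exp_pos. Qed.

Lemma ppow_ge0 (q x : R) : 0 <= ppow q x.
Proof.
  unfold ppow; destruct (Rlt_dec 0 x); [left; apply Rpower_gt0 | lra].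
Qed.

Lemma ppow_le (q x y : R) : 0 <= q -> x <= y -> ppow q x <= ppow q y.
Proof.
  intros Hq Hxy.
  destruct (Rlt_dec 0 x) as [Hx|Hx].
  - rewrite !ppow_pos by lra. apply Rle_Rpower_l; lra.
  - rewrite (ppow_nonpos q x) by lra. apply ppow_ge0.
Qed.

Lemma ppow_1 (q : R) : ppow q 1 = 1.
Proof.
  rewrite ppow_pos by lra. unfold Rpower. rewrite ln_1, Rmult_0_r. apply exp_0.
Qed.

Lemma ppow_mult_exp (q s x : R) : ppow q (exp s * x) = exp (q * s) * ppow q x.
Proof.
  assert (He := exp_pos s).
  destruct (Rlt_dec 0 x) as [Hx|Hx].
  - rewrite !ppow_pos by nra. rewrite <- Rpower_mult_distr by lra.
    unfold Rpower at 1. rewrite ln_exp. reflexivity.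
  - rewrite !ppow_nonpos by nra. ring.
Qed.

Lemma continuous_eps (f : R -> R) (x : R) :
  (forall eps, 0 < eps -> exists d, 0 < d /\
     forall y, Rabs (y - x) < d -> Rabs (f y - f x) < eps) -> continuous f x.
Proof.
  intros H. apply filterlim_locally. intros [eps He].
  destruct (H eps He) as [d [Hd Hy]].
  exists (mkposreal d Hd). intros y Hb. apply Hy, Hb.
Qed.

Lemma continuous_ppow (q x : R) : 0 < q -> continuous (ppow q) x.
Proof.
  intros Hq. destruct (Rtotal_order x 0) as [Hx|[Hx|Hx]].
  - apply continuous_ext_loc with (g := fun _ => 0); [|apply continuous_const].
    exists (mkposreal (- x) ltac:(lra)). intros y Hy.
    change (Rabs (y - x) < - x) in Hy. apply Rabs_def2 in Hy.
    symmetry; apply ppow_nonpos; lra.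
  - subst x. apply continuous_eps. intros eps He.
    exists (Rpower eps (/ q)); split; [apply Rpower_gt0|]. intros y Hy.
    rewrite (ppow_nonpos q 0), Rminus_0_r by lra.
    rewrite Rabs_pos_eq by apply ppow_ge0.
    destruct (Rlt_dec 0 y) as [Hy0|Hy0].
    + rewrite Rminus_0_r, Rabs_pos_eq in Hy by lra.
      rewrite ppow_pos by lra.
      replace eps with (Rpower (Rpower eps (/ q)) q).
      * apply Rlt_Rpower_l; lra.
      * rewrite Rpower_mult, Rinv_l, Rpower_1; lra.
    + rewrite ppow_nonpos; lra.
  - apply continuous_ext_loc with (g := fun y => Rpower y q).
    + exists (mkposreal x Hx). intros y Hy.
      change (Rabs (y - x) < x) in Hy. apply Rabs_def2 in Hy.
      symmetry; apply ppow_pos; lra.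
    + apply (ex_derive_continuous (fun y => Rpower y q) x).
      exists (q * Rpower x (q - 1)).
      apply is_derive_Reals, derivable_pt_lim_power, Hx.
Qed.

(** At 0 the difference quotient is exactly [ppow (q - 1) h], which tends to 0 by continuity. *)
Lemma is_derive_ppow (q x : R) :
  1 < q -> is_derive (ppow q) x (q * ppow (q - 1) x).
Proof.
  intros Hq. destruct (Rtotal_order x 0) as [Hx|[Hx|Hx]].
  - rewrite ppow_nonpos, Rmult_0_r by lra.
    apply is_derive_ext_loc with (f := fun _ => 0);
      [|apply (is_derive_const (V := R_NormedModule) 0)].
    exists (mkposreal (- x) ltac:(lra)). intros y Hy.
    change (Rabs (y - x) < - x) in Hy. apply Rabs_def2 in Hy.
    symmetry; apply ppow_nonpos; lra.
  - subst x. rewrite ppow_nonpos, Rmult_0_r by lra.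
    apply is_derive_Reals. intros eps He.
    assert (Hc := continuous_ppow (q - 1) 0 ltac:(lra)).
    apply filterlim_locally with (eps := mkposreal eps He) in Hc.
    destruct Hc as [d Hd]. exists d. intros h Hh0 Hh.
    specialize (Hd h). rewrite (ppow_nonpos _ 0) in Hd by lra.
    rewrite (ppow_nonpos _ 0), Rplus_0_l by lra.
    replace ((ppow q h - 0) / h) with (ppow (q - 1) h).
    + apply Hd. change (Rabs (h - 0) < d). now rewrite Rminus_0_r.
    + destruct (Rlt_dec 0 h).
      * rewrite !ppow_pos by lra.
        replace (Rpower h q) with (Rpower h (q - 1) * Rpower h 1).
        -- rewrite Rpower_1 by lra. field; lra.
        -- rewrite <- Rpower_plus. f_equal; ring.
      * rewrite !ppow_nonpos by lra. field; lra.
  - rewrite ppow_pos by lra.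
    apply is_derive_ext_loc with (f := fun y => Rpower y q).
    + exists (mkposreal x Hx). intros y Hy.
      change (Rabs (y - x) < x) in Hy. apply Rabs_def2 in Hy.
      symmetry; apply ppow_pos; lra.
    + apply is_derive_Reals, derivable_pt_lim_power, Hx.
Qed.

Lemma mean_value (f f' : R -> R) (x y : R) :
  x <= y -> (forall t, x <= t <= y -> is_derive f t (f' t)) ->
  exists c, x <= c <= y /\ f y - f x = f' c * (y - x).
Proof.
  intros Hxy H.
  destruct (MVT_gen f x y f') as [c [Hc E]].
  - intros t Ht. rewrite Rmin_left, Rmax_right in Ht by lra. apply H; lra.
  - intros t Ht. rewrite Rmin_left, Rmax_right in Ht by lra.
    apply continuity_pt_filterlim, (ex_derive_continuous f t).
    exists (f' t). apply H; lra.
  - rewrite Rmin_left, Rmax_right in Hc by lra. now exists c.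
Qed.

Lemma derive_ge0_le (f f' : R -> R) (x y : R) :
  x <= y -> (forall t, x <= t <= y -> is_derive f t (f' t)) ->
  (forall t, x <= t <= y -> 0 <= f' t) -> f x <= f y.
Proof.
  intros Hxy H Hp. destruct (mean_value f f' x y Hxy H) as [c [Hc E]].
  assert (0 <= f' c * (y - x)) by (apply Rmult_le_pos; [apply Hp|]; lra). lra.
Qed.

Lemma derive_le0_ge (f f' : R -> R) (x y : R) :
  x <= y -> (forall t, x <= t <= y -> is_derive f t (f' t)) ->
  (forall t, x <= t <= y -> f' t <= 0) -> f y <= f x.
Proof.
  intros Hxy H Hp. destruct (mean_value f f' x y Hxy H) as [c [Hc E]].
  assert (0 <= - f' c * (y - x))
    by (apply Rmult_le_pos; [assert (f' c <= 0) by (apply Hp; lra)|]; lra). lra.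
Qed.

(** The derivative [p * ppow (p - 1)] is nonnegative and nondecreasing on all of R, so its value at
    the upper bound [A] dominates it on the whole half-line below [A]. *)
Lemma ppow_lipschitz (p A x y : R) :
  1 < p -> 0 < A -> x <= A -> y <= A ->
  Rabs (ppow p x - ppow p y) <= p * Rpower A (p - 1) * Rabs (x - y).
Proof.
  intros Hp HA.
  assert (W : forall x y, x <= y -> y <= A ->
    Rabs (ppow p x - ppow p y) <= p * Rpower A (p - 1) * Rabs (x - y)).
  { clear x y. intros x y Hxy Hy.
    destruct (mean_value (ppow p) (fun x => p * ppow (p - 1) x) x y Hxy)
      as [c [Hc E]].
    - intros t _. now apply is_derive_ppow.
    - rewrite (Rabs_minus_sym (ppow p x)), (Rabs_minus_sym x), E, Rabs_mult.
      apply Rmult_le_compat_r; [apply Rabs_pos|].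
      assert (H1 := ppow_ge0 (p - 1) c).
      assert (H2 := ppow_le (p - 1) c A ltac:(lra) ltac:(lra)).
      rewrite (ppow_pos _ A) in H2 by lra.
      rewrite Rabs_pos_eq by nra. apply Rmult_le_compat_l; lra. }
  intros Hx Hy. destruct (Rle_dec x y).
  - now apply W.
  - rewrite (Rabs_minus_sym (ppow p x)), (Rabs_minus_sym x). apply W; lra.
Qed.

(** * Limits at infinity *)

Lemma is_lim_m_infty_eps (f : R -> R) (l : R) :
  is_lim f m_infty l <->
  forall eps, 0 < eps -> exists T, forall t, t < T -> Rabs (f t - l) < eps.
Proof.
  split; intros H.
  - apply is_lim_spec in H. intros eps He. exact (H (mkposreal eps He)).
  - apply is_lim_spec. intros eps. apply H, cond_pos.
Qed.

Lemma is_lim_p_infty_eps (f : R -> R) (l : R) :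
  is_lim f p_infty l <->
  forall eps, 0 < eps -> exists T, forall t, T < t -> Rabs (f t - l) < eps.
Proof.
  split; intros H.
  - apply is_lim_spec in H. intros eps He. exact (H (mkposreal eps He)).
  - apply is_lim_spec. intros eps. apply H, cond_pos.
Qed.

Lemma is_lim_opp_arg (f : R -> R) (l : R) :
  is_lim f m_infty l <-> is_lim (fun t => f (- t)) p_infty l.
Proof.
  rewrite is_lim_m_infty_eps, is_lim_p_infty_eps.
  split; intros H eps He; destruct (H eps He) as [T HT];
    exists (- T); intros t Ht.
  - apply HT; lra.
  - rewrite <- (Ropp_involutive t). apply HT; lra.
Qed.

Lemma is_lim_exp_scal_m_infty (k : R) :
  0 < k -> is_lim (fun t => exp (k * t)) m_infty 0.
Proof.
  intros Hk. apply is_lim_m_infty_eps. intros eps He.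
  exists (ln eps / k). intros t Ht.
  rewrite Rminus_0_r, Rabs_pos_eq by (left; apply exp_pos).
  rewrite <- (exp_ln eps He) at 1. apply exp_increasing.
  apply Rmult_lt_compat_l with (r := k) in Ht; [|lra].
  replace (k * (ln eps / k)) with (ln eps) in Ht by (field; lra). exact Ht.
Qed.

Lemma is_lim_m_infty_squeeze0 (f g : R -> R) (T : R) :
  (forall t, t <= T -> Rabs (f t) <= g t) -> is_lim g m_infty 0 ->
  is_lim f m_infty 0.
Proof.
  rewrite !is_lim_m_infty_eps. intros H Hg eps He.
  destruct (Hg eps He) as [T' HT]. exists (Rmin T T'). intros t Ht.
  assert (Ht1 := Rmin_l T T'). assert (Ht2 := Rmin_r T T').
  specialize (HT t ltac:(lra)). specialize (H t ltac:(lra)).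
  rewrite Rminus_0_r in *. apply Rabs_def2 in HT. lra.
Qed.

(** The limit at -oo acts as an initial value: this is how differential inequalities are integrated
    from -oo. *)
Lemma nondecreasing_ge_lim (f f' : R -> R) (l T : R) :
  (forall t, t <= T -> is_derive f t (f' t)) ->
  (forall t, t <= T -> 0 <= f' t) -> is_lim f m_infty l ->
  forall t, t <= T -> l <= f t.
Proof.
  intros Hd Hp Hl t Ht. apply Rnot_lt_le. intros Hlt.
  apply is_lim_m_infty_eps with (eps := l - f t) in Hl; [|lra].
  destruct Hl as [T' HT'].
  set (s := Rmin t T' - 1).
  assert (H1 := Rmin_l t T'). assert (H2 := Rmin_r t T').
  assert (Hs : Rabs (f s - l) < l - f t) by (apply HT'; unfold s; lra).
  apply Rabs_def2 in Hs.
  assert (f s <= f t).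
  { apply derive_ge0_le with (f' := f'); unfold s; intros; try lra.
    - apply Hd; lra.
    - apply Hp; lra. }
  lra.
Qed.

Lemma nonincreasing_le_lim (f f' : R -> R) (l T : R) :
  (forall t, t <= T -> is_derive f t (f' t)) ->
  (forall t, t <= T -> f' t <= 0) -> is_lim f m_infty l ->
  forall t, t <= T -> f t <= l.
Proof.
  intros Hd Hp Hl t Ht.
  assert (- l <= - f t); [|lra].
  apply nondecreasing_ge_lim with
    (f := fun t => - f t) (f' := fun t => - f' t) (T := T); auto.
  - intros s Hs. apply (is_derive_opp f), Hd, Hs.
  - intros s Hs. specialize (Hp s Hs). lra.
  - apply (is_lim_opp f m_infty l), Hl.
Qed.

(** * A fixed point theorem in a weighted norm *)

(** Banach iteration from [f0] for the norm [sup |f| / w], carried out pointwise. An unbounded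
    weight makes [T] a contraction on the whole line at once, so no local solutions have to be
    glued; [C0] is the weighted length of the first step. *)
Lemma weighted_fixed_point (T : (R -> R) -> R -> R) (w f0 : R -> R) (C0 : R) :
  (forall x, continuous w x) -> (forall x, 0 < w x) ->
  (forall f, (forall x, continuous f x) -> forall x, continuous (T f) x) ->
  (forall f g C, (forall x, continuous f x) -> (forall x, continuous g x) ->
     (forall x, Rabs (f x - g x) <= C * w x) ->
     forall x, Rabs (T f x - T g x) <= C / 2 * w x) ->
  (forall x, continuous f0 x) -> (forall x, Rabs (T f0 x - f0 x) <= C0 * w x) ->
  exists h, (forall x, continuous h x) /\ forall x, T h x = h x.
Proof.
  intros Hw Hw0 HT Hc Hf0 Hi.
  set (F := fix F n := match n with O => f0 | S k => T (F k) end).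
  assert (FC : forall n x, continuous (F n) x) by (induction n; simpl; auto).
  assert (HC0 : 0 <= C0).
  { assert (H := Hi 0). assert (H1 := Rabs_pos (T f0 0 - f0 0)).
    assert (H2 := Hw0 0). nra. }
  assert (D : forall n x, Rabs (F (S n) x - F n x) <= C0 * (/ 2) ^ n * w x).
  { induction n; intros x.
    - simpl. rewrite Rmult_1_r. apply Hi.
    - replace (C0 * (/ 2) ^ S n) with (C0 * (/ 2) ^ n / 2) by (simpl; field).
      apply (Hc (F (S n)) (F n)); auto. }
  assert (Pp : forall n, 0 < (/ 2) ^ n) by (intro; apply pow_lt; lra).
  assert (D2 : forall n k x,
    Rabs (F (n + k)%nat x - F n x) <= 2 * C0 * (/ 2) ^ n * w x).
  (* The factor [1 - (/ 2) ^ k] is the partial geometric sum; without it the induction on [k] does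
     not close. *)
  { assert (D3 : forall n k x, Rabs (F (n + k)%nat x - F n x)
        <= 2 * C0 * (/ 2) ^ n * (1 - (/ 2) ^ k) * w x).
    { intros n k x. induction k.
      - rewrite Nat.add_0_r. simpl. rewrite Rminus_diag, Rabs_R0. lra.
      - rewrite Nat.add_succ_r.
        assert (H1 := Rabs_triang (F (S (n + k)) x - F (n + k)%nat x)
                        (F (n + k)%nat x - F n x)).
        replace (F (S (n + k)) x - F (n + k)%nat x + (F (n + k)%nat x - F n x))
          with (F (S (n + k)) x - F n x) in H1 by ring.
        assert (H2 := D (n + k)%nat x). rewrite pow_add in H2.
        replace (2 * C0 * (/ 2) ^ n * (1 - (/ 2) ^ S k) * w x) with
          (C0 * ((/ 2) ^ n * (/ 2) ^ k) * w x
           + 2 * C0 * (/ 2) ^ n * (1 - (/ 2) ^ k) * w x) by (simpl; field).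
        lra. }
    intros n k x. eapply Rle_trans; [apply D3|].
    assert (0 <= C0 * (/ 2) ^ n * (/ 2) ^ k * w x).
    { repeat apply Rmult_le_pos; auto; left; auto. }
    lra. }
  assert (Small : forall M eps, 0 <= M -> 0 < eps ->
            exists N, forall n, (N <= n)%nat -> M * (/ 2) ^ n < eps).
  { intros M eps HM He.
    destruct (pow_lt_1_zero (/ 2) ltac:(rewrite Rabs_pos_eq; lra)
                (eps / (M + 1)) ltac:(apply Rdiv_lt_0_compat; lra)) as [N HN].
    exists N. intros n Hn. specialize (HN n Hn).
    rewrite Rabs_pos_eq in HN by (left; auto).
    apply Rmult_lt_compat_l with (r := M + 1) in HN; [|lra].
    replace ((M + 1) * (eps / (M + 1))) with eps in HN by (field; lra).
    specialize (Pp n). nra. }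
  assert (L : forall x, ex_finite_lim_seq (fun n => F n x)).
  { intros x. apply ex_lim_seq_cauchy_corr. intros [eps He]. simpl.
    destruct (Small (2 * C0 * w x) (eps / 2)) as [N HN].
    - specialize (Hw0 x). nra.
    - lra.
    - exists N. intros n m Hn Hm.
      assert (Q : forall n, (N <= n)%nat -> Rabs (F n x - F N x) < eps / 2).
      { intros j Hj. replace j with (N + (j - N))%nat by lia.
        eapply Rle_lt_trans; [apply D2|].
        replace (2 * C0 * (/ 2) ^ N * w x) with (2 * C0 * w x * (/ 2) ^ N) by ring.
        apply HN; lia. }
      assert (H1 := Q n Hn). assert (H2 := Q m Hm).
      apply Rabs_def2 in H1. apply Rabs_def2 in H2. apply Rabs_def1; lra. }
  set (h := fun x => real (Lim_seq (fun n => F n x))).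
  assert (Lh : forall x, is_lim_seq (fun n => F n x) (h x)).
  { intros x. apply Lim_seq_correct', L. }
  assert (Dh : forall n x, Rabs (h x - F n x) <= 2 * C0 * (/ 2) ^ n * w x).
  { intros n x. apply Rnot_lt_le. intros Hlt.
    set (d := Rabs (h x - F n x) - 2 * C0 * (/ 2) ^ n * w x).
    assert (Hd : 0 < d) by (unfold d; lra).
    assert (Hl := Lh x). apply is_lim_seq_spec in Hl.
    destruct (Hl (mkposreal d Hd)) as [N HN]. simpl in HN.
    specialize (HN (n + N)%nat ltac:(lia)). specialize (D2 n N x).
    assert (H1 := Rabs_triang (h x - F (n + N)%nat x) (F (n + N)%nat x - F n x)).
    replace (h x - F (n + N)%nat x + (F (n + N)%nat x - F n x))
      with (h x - F n x) in H1 by ring.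
    rewrite Rabs_minus_sym in HN. unfold d in HN. lra. }
  (* Near [x] the weight stays below [w x + 1], so the convergence is uniform there and continuity
     passes to the limit. *)
  assert (Ch : forall x, continuous h x).
  { intros x. apply continuous_eps. intros eps He.
    assert (Hwx := Hw x). apply filterlim_locally with
      (eps := mkposreal 1 Rlt_0_1) in Hwx. destruct Hwx as [d1 Hd1].
    assert (HM : 0 < w x + 1) by (specialize (Hw0 x); lra).
    destruct (Small (2 * C0 * (w x + 1)) (eps / 3)) as [N HN]; [nra|lra|].
    specialize (HN N (le_n N)).
    assert (HF := FC N x). apply filterlim_locally with
      (eps := mkposreal (eps / 3) ltac:(lra)) in HF. destruct HF as [d2 Hd2].
    assert (Hdd1 := cond_pos d1). assert (Hdd2 := cond_pos d2).
    exists (Rmin d1 d2). split; [now apply Rmin_pos|]. intros y Hy.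
    assert (Hm1 := Rmin_l d1 d2). assert (Hm2 := Rmin_r d1 d2).
    specialize (Hd1 y ltac:(change (Rabs (y - x) < d1); lra)).
    specialize (Hd2 y ltac:(change (Rabs (y - x) < d2); lra)).
    change (Rabs (w y - w x) < 1) in Hd1.
    change (Rabs (F N y - F N x) < eps / 3) in Hd2.
    apply Rabs_def2 in Hd1.
    assert (Q : forall z, w z <= w x + 1 -> Rabs (h z - F N z) < eps / 3).
    { intros z Hz. eapply Rle_lt_trans; [apply Dh|].
      eapply Rle_lt_trans; [|apply HN].
      replace (2 * C0 * (w x + 1) * (/ 2) ^ N)
        with (2 * C0 * (/ 2) ^ N * (w x + 1)) by ring.
      apply Rmult_le_compat_l; [|lra]. specialize (Pp N). nra. }
    assert (Q1 := Q y ltac:(lra)). assert (Q2 := Q x ltac:(lra)).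
    apply Rabs_def2 in Q1. apply Rabs_def2 in Q2. apply Rabs_def2 in Hd2.
    apply Rabs_def1; lra. }
  exists h. split; [exact Ch|]. intros x.
  apply Rminus_diag_uniq. apply Rabs_eq_0. apply Rle_antisym; [|apply Rabs_pos].
  apply Rnot_lt_le. intros Hlt.
  destruct (Small (3 * C0 * w x) (Rabs (T h x - h x))) as [N HN];
    [specialize (Hw0 x); nra|exact Hlt|].
  specialize (HN N (le_n N)).
  assert (H1 := Hc h (F N) _ Ch (FC N) (Dh N) x).
  assert (H2 := Dh (S N) x). change (F (S N) x) with (T (F N) x) in H2.
  assert (H3 := Rabs_triang (T h x - T (F N) x) (T (F N) x - h x)).
  replace (T h x - T (F N) x + (T (F N) x - h x)) with (T h x - h x) in H3 by ring.
  rewrite (Rabs_minus_sym (T (F N) x)) in H3. simpl in H2.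
  assert (0 <= C0 * (/ 2) ^ N * w x)
    by (repeat apply Rmult_le_pos; auto; left; auto).
  lra.
Qed.

(** * Existence of the orbit leaving the saddle *)

Lemma is_derive_RInt_continuous (f : R -> R) (a x : R) :
  (forall y, continuous f y) -> is_derive (fun x => RInt f a x) x (f x).
Proof.
  intros Hf. apply (is_derive_RInt f (fun x => RInt f a x) a x); [|apply Hf].
  apply filter_forall. intros y. apply (RInt_correct f).
  apply (ex_RInt_continuous f). auto.
Qed.

Lemma is_derive_continuous (f : R -> R) (x l : R) :
  is_derive f x l -> continuous f x.
Proof. intros H. apply (ex_derive_continuous f). now exists l. Qed.

Section Picard.

Variables (p q : R).
Hypotheses (Hp : 1 < p) (Hq : 0 < q).

(** Truncating at 1 makes the nonlinearity bounded and globally Lipschitz with constant [p]; the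
    truncation is inactive on the solution, which never exceeds 1. *)
Let phi (x : R) : R := ppow p (Rmin x 1).

Lemma phi_bounds (x : R) : 0 <= phi x <= 1.
Proof.
  split; [apply ppow_ge0|]. rewrite <- (ppow_1 p).
  apply ppow_le; [lra|apply Rmin_r].
Qed.

Lemma phi_lipschitz (x y : R) : Rabs (phi x - phi y) <= p * Rabs (x - y).
Proof.
  unfold phi.
  assert (H := ppow_lipschitz p 1 (Rmin x 1) (Rmin y 1) Hp Rlt_0_1
                 (Rmin_r _ _) (Rmin_r _ _)).
  replace (Rpower 1 (p - 1)) with 1 in H
    by (unfold Rpower; now rewrite ln_1, Rmult_0_r, exp_0).
  rewrite Rmult_1_r in H. eapply Rle_trans; [apply H|].
  apply Rmult_le_compat_l; [lra|].
  unfold Rmin, Rabs.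
  destruct (Rle_dec x 1), (Rle_dec y 1); repeat destruct Rcase_abs; lra.
Qed.

Lemma continuous_phi_comp (f : R -> R) (x : R) :
  continuous f x -> continuous (fun x => phi (f x)) x.
Proof.
  intros Hf. apply (continuous_comp f phi); [exact Hf|].
  apply continuous_eps. intros eps He. exists (eps / p).
  split; [apply Rdiv_lt_0_compat; lra|]. intros y Hy.
  eapply Rle_lt_trans; [apply phi_lipschitz|].
  apply Rmult_lt_compat_l with (r := p) in Hy; [|lra].
  replace (p * (eps / p)) with eps in Hy by (field; lra). exact Hy.
Qed.

(** Here [q = 1 / m], so [x] is a constant multiple of [r^q]. From [du'/dr = - h^p] and
    [d(u - x u')/dr = x h^p], with [u(0) = 0] and [u'(0) = 1], integration gives [u' = 1 - A] and
    [u / x = 1 - A + B / r^q], the constant in [x] cancelling. For [r <= 0] the operator [T] takes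
    its value at 0, which keeps [T f] continuous on R. *)
Let A (f : R -> R) (r : R) : R := RInt (fun s => phi (f s)) 0 r.
Let B (f : R -> R) (r : R) : R := RInt (fun s => ppow q s * phi (f s)) 0 r.
Let T (f : R -> R) (r : R) : R :=
  if Rle_dec r 0 then 1 else 1 - A f r + B f r / ppow q r.

Lemma continuous_B_integrand (f : R -> R) :
  (forall x, continuous f x) ->
  forall x, continuous (fun s => ppow q s * phi (f s)) x.
Proof.
  intros Hf x. apply (continuous_mult (ppow q) (fun s => phi (f s))).
  - now apply continuous_ppow.
  - now apply continuous_phi_comp.
Qed.

Lemma is_derive_A (f : R -> R) (r : R) :
  (forall x, continuous f x) -> is_derive (A f) r (phi (f r)).
Proof.
  intros Hf. apply (is_derive_RInt_continuous (fun s => phi (f s))).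
  intros; now apply continuous_phi_comp.
Qed.

Lemma is_derive_B (f : R -> R) (r : R) :
  (forall x, continuous f x) -> is_derive (B f) r (ppow q r * phi (f r)).
Proof.
  intros Hf. apply (is_derive_RInt_continuous (fun s => ppow q s * phi (f s))).
  now apply continuous_B_integrand.
Qed.

Lemma A_at_0 (f : R -> R) : A f 0 = 0.
Proof. apply (RInt_point 0 (fun s => phi (f s))). Qed.

Lemma B_at_0 (f : R -> R) : B f 0 = 0.
Proof. apply (RInt_point 0 (fun s => ppow q s * phi (f s))). Qed.

Lemma A_bounds (f : R -> R) (r : R) :
  (forall x, continuous f x) -> 0 <= r -> 0 <= A f r <= r.
Proof.
  intros Hf Hr.
  destruct (mean_value (A f) (fun r => phi (f r)) 0 r Hr) as [c [Hc E]].
  - intros; now apply is_derive_A.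
  - rewrite A_at_0, !Rminus_0_r in E. rewrite E.
    assert (H := phi_bounds (f c)). nra.
Qed.

Lemma B_bounds (f : R -> R) (r : R) :
  (forall x, continuous f x) -> 0 <= r -> 0 <= B f r <= ppow q r * A f r.
Proof.
  intros Hf Hr. split.
  - rewrite <- (B_at_0 f).
    apply derive_ge0_le with (f' := fun r => ppow q r * phi (f r)); auto.
    + intros; now apply is_derive_B.
    + intros. apply Rmult_le_pos; [apply ppow_ge0|apply phi_bounds].
  - assert (H : ppow q r * A f 0 - B f 0 <= ppow q r * A f r - B f r).
    { apply derive_ge0_le with (f := fun s => ppow q r * A f s - B f s)
        (f' := fun s => ppow q r * phi (f s) - ppow q s * phi (f s)); auto.
      - intros t _. apply (is_derive_minus (fun s => ppow q r * A f s) (B f)).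
        + apply (is_derive_scal (A f)). now apply is_derive_A.
        + now apply is_derive_B.
      - intros t Ht. rewrite <- Rmult_minus_distr_r.
        apply Rmult_le_pos; [|apply phi_bounds].
        assert (ppow q t <= ppow q r) by (apply ppow_le; lra). lra. }
    rewrite A_at_0, B_at_0 in H. lra.
Qed.

(** The upper bound holds for every [f], hence for the fixed point, and so removes the truncation;
    both bounds together give continuity of [T f] at 0. *)
Lemma T_bounds (f : R -> R) (r : R) :
  (forall x, continuous f x) -> 0 <= r -> 1 - r <= T f r <= 1.
Proof.
  intros Hf Hr. unfold T. destruct (Rle_dec r 0); [lra|].
  assert (HA := A_bounds f r Hf Hr). assert (HB := B_bounds f r Hf Hr).
  assert (Hk : 0 < ppow q r) by (rewrite ppow_pos; [apply Rpower_gt0|lra]).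
  assert (0 <= B f r / ppow q r)
    by (apply Rmult_le_pos; [lra|left; now apply Rinv_0_lt_compat]).
  assert (B f r / ppow q r <= A f r).
  { apply Rmult_le_reg_r with (ppow q r); [exact Hk|].
    replace (B f r / ppow q r * ppow q r) with (B f r) by (field; lra). lra. }
  lra.
Qed.

Lemma continuous_T (f : R -> R) :
  (forall x, continuous f x) -> forall x, continuous (T f) x.
Proof.
  intros Hf r. destruct (Rle_lt_dec r 0) as [Hr|Hr].
  - apply continuous_eps. intros eps He. exists eps. split; [exact He|].
    intros y Hy. apply Rabs_def2 in Hy.
    replace (T f r) with 1 by (unfold T; destruct (Rle_dec r 0); lra).
    destruct (Rle_lt_dec y 0) as [Hy0|Hy0].
    + unfold T. destruct (Rle_dec y 0); [|lra].
      rewrite Rminus_diag, Rabs_R0. exact He.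
    + assert (H := T_bounds f y Hf (Rlt_le _ _ Hy0)). apply Rabs_def1; lra.
  - apply continuous_ext_loc with
      (g := fun r => 1 - A f r + B f r * / ppow q r).
    + exists (mkposreal r Hr). intros y Hy.
      change (Rabs (y - r) < r) in Hy. apply Rabs_def2 in Hy.
      unfold T. destruct (Rle_dec y 0); [lra|reflexivity].
    + apply (continuous_plus (fun r => 1 - A f r) (fun r => B f r * / ppow q r)).
      * apply (continuous_minus (fun _ => 1) (A f)); [apply continuous_const|].
        eapply is_derive_continuous. now apply is_derive_A.
      * apply (continuous_mult (B f) (fun r => / ppow q r)).
        -- eapply is_derive_continuous. now apply is_derive_B.
        -- apply (continuous_comp (ppow q) Rinv); [now apply continuous_ppow|].
           apply continuous_Rinv. rewrite ppow_pos by lra.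
           assert (H := Rpower_gt0 r q). lra.
Qed.

(** [T f - T g] at [r] is minus the integral over [[0, r]] of
    [(1 - (s / r)^q) (phi (f s) - phi (g s))]. The kernel lies in [[0, 1]], and integrating
    [p C e^(2 p s)] leaves at most [C / 2 * e^(2 p r)]: the exponent [2 p] is chosen for this factor
    1/2. *)
Lemma T_contraction (f g : R -> R) (C : R) :
  (forall x, continuous f x) -> (forall x, continuous g x) ->
  (forall x, Rabs (f x - g x) <= C * exp (2 * p * x)) ->
  forall x, Rabs (T f x - T g x) <= C / 2 * exp (2 * p * x).
Proof.
  intros Hf Hg H r.
  assert (HC : 0 <= C).
  { assert (H1 := H 0). assert (H2 := Rabs_pos (f 0 - g 0)).
    rewrite Rmult_0_r, exp_0 in H1. lra. }
  assert (He : forall x, 0 < exp (2 * p * x)) by (intro; apply exp_pos).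
  unfold T. destruct (Rle_dec r 0) as [Hr|Hr].
  { rewrite Rminus_diag, Rabs_R0. specialize (He r). nra. }
  assert (Hk : 0 < ppow q r) by (rewrite ppow_pos; [apply Rpower_gt0|lra]).
  (* With [r] frozen in the factor [ppow q r], [F] is differentiable in [s] down to 0, and
     [F r = - ppow q r * (T f r - T g r)]; [G] is its majorant. *)
  set (F := fun s => ppow q r * (A f s - A g s) - (B f s - B g s)).
  set (G := fun s => ppow q r * (C / 2 * exp (2 * p * s))).
  set (F' := fun s => (ppow q r - ppow q s) * (phi (f s) - phi (g s))).
  set (G' := fun s => ppow q r * (C * p * exp (2 * p * s))).
  assert (DF : forall s, is_derive F s (F' s)).
  { intros s. unfold F, F'.
    replace ((ppow q r - ppow q s) * (phi (f s) - phi (g s))) with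
      (ppow q r * (phi (f s) - phi (g s))
       - (ppow q s * phi (f s) - ppow q s * phi (g s))) by ring.
    apply (is_derive_minus (fun s => ppow q r * (A f s - A g s))
             (fun s => B f s - B g s)).
    - apply (is_derive_scal (fun s => A f s - A g s)).
      apply (is_derive_minus (A f) (A g)); now apply is_derive_A.
    - apply (is_derive_minus (B f) (B g)); now apply is_derive_B. }
  assert (DG : forall s, is_derive G s (G' s)).
  { intros s. unfold G, G'. auto_derive; [trivial|]. field. }
  assert (HFG : forall s, 0 <= s <= r -> Rabs (F' s) <= G' s).
  { intros s Hs. unfold F', G'. rewrite Rabs_mult.
    assert (H1 := ppow_ge0 q s).
    assert (H2 := ppow_le q s r ltac:(lra) ltac:(lra)).
    rewrite Rabs_pos_eq by lra.
    apply Rmult_le_compat; [lra|apply Rabs_pos|lra|].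
    eapply Rle_trans; [apply phi_lipschitz|].
    specialize (H s). apply Rmult_le_compat_l with (r := p) in H; lra. }
  assert (HF0 : F 0 = 0) by (unfold F; rewrite !A_at_0, !B_at_0; ring).
  assert (HG0 : 0 <= G 0).
  { unfold G. specialize (He 0).
    repeat apply Rmult_le_pos; lra. }
  assert (U1 : F r <= G r).
  { assert (G 0 - F 0 <= G r - F r); [|lra].
    apply derive_ge0_le with (f := fun s => G s - F s)
      (f' := fun s => G' s - F' s); [lra| |].
    - intros s _. now apply (is_derive_minus G F).
    - intros s Hs. specialize (HFG s Hs). assert (H1 := Rle_abs (F' s)). lra. }
  assert (U2 : - F r <= G r).
  { assert (G 0 + F 0 <= G r + F r); [|lra].
    apply derive_ge0_le with (f := fun s => G s + F s)
      (f' := fun s => G' s + F' s); [lra| |].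
    - intros s _. now apply (is_derive_plus G F).
    - intros s Hs. specialize (HFG s Hs). assert (H1 := Rle_abs (- F' s)).
      rewrite Rabs_Ropp in H1. lra. }
  replace (1 - A f r + B f r / ppow q r - (1 - A g r + B g r / ppow q r))
    with (- F r / ppow q r) by (unfold F; field; lra).
  unfold Rdiv at 1. rewrite Rabs_mult, (Rabs_pos_eq (/ ppow q r)), Rabs_Ropp
    by (left; now apply Rinv_0_lt_compat).
  apply Rmult_le_reg_r with (ppow q r); [exact Hk|].
  rewrite Rmult_assoc, Rinv_l, Rmult_1_r by lra.
  unfold G in U1, U2. apply Rabs_le. lra.
Qed.

Lemma picard_solution :
  exists H A B : R -> R, forall r, 0 < r ->
    H r = 1 - A r + B r / ppow q r /\
    is_derive A r (ppow p (H r)) /\ is_derive B r (ppow q r * ppow p (H r)) /\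
    0 <= A r <= r /\ 0 <= B r <= ppow q r * A r.
Proof.
  destruct (weighted_fixed_point T (fun x => exp (2 * p * x)) (fun _ => 1) 1)
    as [h [Ch Eh]].
  - intros x. apply (is_derive_continuous _ x (2 * p * exp (2 * p * x))).
    auto_derive; [trivial|ring].
  - intros; apply exp_pos.
  - apply continuous_T.
  - apply T_contraction.
  - intros; apply continuous_const.
  - intros x. assert (He := exp_pos (2 * p * x)).
    destruct (Rle_lt_dec x 0) as [Hx|Hx].
    + unfold T. destruct (Rle_dec x 0); [|lra].
      rewrite Rminus_diag, Rabs_R0. lra.
    + assert (H := T_bounds (fun _ => 1) x
                     (fun x => continuous_const _ _) (Rlt_le _ _ Hx)).
      assert (H1 := exp_ineq1_le (2 * p * x)).
      apply Rabs_le. nra.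
  - exists h, (A h), (B h). intros r Hr.
    assert (Hh1 : h r <= 1)
      by (rewrite <- Eh; apply T_bounds; [exact Ch|lra]).
    replace (ppow p (h r)) with (phi (h r))
      by (unfold phi; now rewrite Rmin_left).
    split; [|split; [|split; [|split]]].
    + rewrite <- Eh at 1. unfold T. destruct (Rle_dec r 0); [lra|reflexivity].
    + now apply is_derive_A.
    + now apply is_derive_B.
    + apply A_bounds; [exact Ch|lra].
    + apply B_bounds; [exact Ch|lra].
Qed.

End Picard.

(** In logarithmic time [x = e^t] these are [h = u / x] and [Q = u'], with [r = e^(m t) / m]. The
    lower bound on [Q] is [A <= r]; it yields positivity near -oo. *)
Lemma exists_unstable_hQ (p m : R) :
  1 < p -> 0 < m ->
  exists h Q : R -> R, forall t,
    is_derive h t (Q t - h t) /\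
    is_derive Q t (- exp (m * t) * ppow p (h t)) /\
    1 - exp (m * t) / m <= Q t /\ Q t <= h t <= 1.
Proof.
  intros Hp Hm.
  destruct (picard_solution p (/ m) Hp (Rinv_0_lt_compat _ Hm))
    as [H [A [B HAB]]].
  set (r := fun t => exp (m * t) / m).
  assert (Hr : forall t, 0 < r t)
    by (intro; apply Rdiv_lt_0_compat; [apply exp_pos|exact Hm]).
  assert (Dr : forall t, is_derive r t (exp (m * t))).
  { intros t. unfold r. auto_derive; [trivial|field; lra]. }
  (* [r^(1/m) = K e^t], so division by [r^q] becomes multiplication by [e^(-t) / K]. *)
  set (K := ppow (/ m) (/ m)).
  assert (Er : forall t, ppow (/ m) (r t) = exp t * K).
  { intros t. unfold r, Rdiv. rewrite ppow_mult_exp. unfold K.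
    f_equal. f_equal. field. lra. }
  assert (HK : 0 < K)
    by (unfold K; rewrite ppow_pos; [apply Rpower_gt0|now apply Rinv_0_lt_compat]).
  exists (fun t => 1 - A (r t) + B (r t) * exp (- t) / K), (fun t => 1 - A (r t)).
  intros t. destruct (HAB (r t) (Hr t)) as [EH [DA [DB [BA BB]]]].
  rewrite Er in *.
  assert (Het : exp t * exp (- t) = 1)
    by (rewrite <- exp_plus, Rplus_opp_r; apply exp_0).
  assert (He := exp_pos t). assert (He' := exp_pos (- t)).
  assert (EH' : H (r t) = 1 - A (r t) + B (r t) * exp (- t) / K).
  { rewrite EH. replace (exp (- t)) with (/ exp t) by (rewrite exp_Ropp; reflexivity).
    field. lra. }
  assert (DAr : is_derive (fun t => A (r t)) t (exp (m * t) * ppow p (H (r t))))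
    by apply (is_derive_comp A r t _ _ DA (Dr t)).
  assert (DBr := is_derive_comp B r t _ _ DB (Dr t)).
  change (is_derive (fun t => B (r t)) t
     (exp (m * t) * (exp t * K * ppow p (H (r t))))) in DBr.
  assert (V : 0 <= B (r t) * exp (- t) / K <= A (r t)).
  { split.
    - apply Rmult_le_pos; [nra|left; now apply Rinv_0_lt_compat].
    - apply Rmult_le_reg_r with K; [exact HK|].
      replace (B (r t) * exp (- t) / K * K) with (B (r t) * exp (- t))
        by (field; lra). nra. }
  cbv beta. rewrite <- EH'.
  split; [|split; [|split]].
  - rewrite EH'. apply is_derive_ext with
      (f := fun t => (1 - A (r t)) + / K * (B (r t) * exp (- t)));
      [intros s; match goal with |- ?x = ?y => change (@eq R x y) end; field; lra|].
    evar_last.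
    + apply (is_derive_plus (fun t => 1 - A (r t))
               (fun t => / K * (B (r t) * exp (- t)))).
      * apply (is_derive_minus (fun _ => 1) (fun t => A (r t)));
          [apply (is_derive_const (V := R_NormedModule) 1)|apply DAr].
      * apply (is_derive_scal (fun t => B (r t) * exp (- t))).
        apply (is_derive_mult (fun t => B (r t)) (fun t => exp (- t)) t _
                 (- exp (- t)) DBr); [|intros; apply Rmult_comm].
        auto_derive; [trivial|ring].
    + unfold plus, minus, opp, zero, mult; simpl.
      replace (/ K * (exp (m * t) * (exp t * K * ppow p (H (r t))) * exp (- t)
                      + B (r t) * - exp (- t)))
        with (exp (m * t) * ppow p (H (r t)) * (exp t * exp (- t))
              - B (r t) * exp (- t) / K) by (field; lra).
      rewrite Het. change plus with Rplus. ring.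
  - evar_last.
    + apply (is_derive_minus (fun _ => 1) (fun t => A (r t)));
          [apply (is_derive_const (V := R_NormedModule) 1)|apply DAr].
    + unfold minus, plus, opp, zero; simpl. ring.
  - fold (r t). lra.
  - rewrite EH'. lra.
Qed.

(** * The autonomous equation and its energy *)

Definition emden (a p : R) (y z : R -> R) : Prop :=
  forall t, is_derive y t (z t) /\
    is_derive z t ((1 - 2 * a) * z t + a * (1 - a) * y t - ppow p (y t)).

(** Since [u = e^t h], the variable [y = e^(-a t) u] is [e^((1-a) t) h]. The exponent
    [(p - 1)(1 - a)] in the forcing is exactly what the factor [e^(p (1-a) t)] from [y^p] absorbs,
    so time disappears. *)
Lemma emden_of_hQ (a p : R) (h Q : R -> R) :
  (forall t, is_derive h t (Q t - h t) /\
     is_derive Q t (- exp ((p - 1) * (1 - a) * t) * ppow p (h t))) ->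
  emden a p (fun t => exp ((1 - a) * t) * h t)
    (fun t => exp ((1 - a) * t) * (Q t - a * h t)).
Proof.
  intros H t. destruct (H t) as [Hh HQ]. split.
  - auto_derive; [now exists (Q t - h t)|].
    change (fun x => h x) with h. rewrite (is_derive_unique _ _ _ Hh). ring.
  - auto_derive.
    { split; [eexists; exact HQ|split; [eexists; exact Hh|trivial]]. }
    change (fun x => h x) with h. change (fun x => Q x) with Q.
    rewrite (is_derive_unique _ _ _ Hh), (is_derive_unique _ _ _ HQ).
    rewrite ppow_mult_exp.
    replace (exp (p * ((1 - a) * t))) with
      (exp ((1 - a) * t) * exp ((p - 1) * (1 - a) * t))
      by (rewrite <- exp_plus; f_equal; ring).
    ring.
Qed.

Lemma hQ_of_emden (a p : R) (y z : R -> R) :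
  emden a p y z -> forall t,
  is_derive (fun t => exp (- (1 - a) * t) * y t) t
    (exp (- (1 - a) * t) * (z t + a * y t) - exp (- (1 - a) * t) * y t) /\
  is_derive (fun t => exp (- (1 - a) * t) * (z t + a * y t)) t
    (- exp (- (1 - a) * t) * ppow p (y t)).
Proof.
  intros H t. destruct (H t) as [Hy Hz]. split.
  - auto_derive; [eexists; exact Hy|].
    change (fun x => y x) with y. rewrite (is_derive_unique _ _ _ Hy). ring.
  - auto_derive.
    { split; [eexists; exact Hz|split; [eexists; exact Hy|trivial]]. }
    change (fun x => y x) with y. change (fun x => z x) with z.
    rewrite (is_derive_unique _ _ _ Hy), (is_derive_unique _ _ _ Hz). ring.
Qed.

Lemma is_lim_m_infty_mult0 (f g : R -> R) :
  is_lim f m_infty 0 -> is_lim g m_infty 0 ->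
  is_lim (fun t => f t * g t) m_infty 0.
Proof.
  intros Hf Hg. replace (Finite 0) with (Rbar_mult 0 0)
    by (simpl; f_equal; ring).
  now apply is_lim_mult.
Qed.

(** As soon as [e^(m t) < m] one has [0 < Q <= h <= 1]; then [y] and [z] are bounded by
    [e^((1-a) t)], which decays at -oo. *)
Lemma exists_unstable (a p : R) :
  0 < a < 1 -> 1 < p ->
  exists y z : R -> R, emden a p y z /\
    is_lim y m_infty 0 /\ is_lim z m_infty 0 /\
    exists T, forall t, t <= T -> 0 < y t.
Proof.
  intros Ha Hp. set (m := (p - 1) * (1 - a)).
  assert (Hm : 0 < m) by (apply Rmult_lt_0_compat; lra).
  destruct (exists_unstable_hQ p m Hp Hm) as [h [Q H]].
  exists (fun t => exp ((1 - a) * t) * h t),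
    (fun t => exp ((1 - a) * t) * (Q t - a * h t)).
  assert (HT : exists T, forall t, t <= T -> 0 < Q t).
  { destruct (proj1 (is_lim_m_infty_eps _ _) (is_lim_exp_scal_m_infty m Hm) m Hm)
      as [T HT].
    exists (T - 1). intros t Ht. specialize (HT t ltac:(lra)).
    rewrite Rminus_0_r, Rabs_pos_eq in HT by (left; apply exp_pos).
    destruct (H t) as [_ [_ [H1 _]]].
    assert (exp (m * t) / m < 1).
    { apply Rmult_lt_reg_r with m; [exact Hm|].
      replace (exp (m * t) / m * m) with (exp (m * t)) by (field; lra). lra. }
    lra. }
  destruct HT as [T HT].
  split; [|split; [|split]].
  - apply emden_of_hQ. intros t. now destruct (H t) as [H1 [H2 _]].
  - apply is_lim_m_infty_squeeze0 with (g := fun t => exp ((1 - a) * t)) (T := T).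
    + intros t Ht. specialize (HT t Ht). destruct (H t) as [_ [_ [_ H1]]].
      assert (He := exp_pos ((1 - a) * t)). rewrite Rabs_pos_eq; nra.
    + apply is_lim_exp_scal_m_infty; lra.
  - apply is_lim_m_infty_squeeze0 with (g := fun t => exp ((1 - a) * t)) (T := T).
    + intros t Ht. specialize (HT t Ht). destruct (H t) as [_ [_ [_ H1]]].
      assert (He := exp_pos ((1 - a) * t)).
      rewrite Rabs_mult, Rabs_pos_eq by lra.
      rewrite <- (Rmult_1_r (exp _)) at 2. apply Rmult_le_compat_l; [lra|].
      apply Rabs_le. nra.
    + apply is_lim_exp_scal_m_infty; lra.
  - exists T. intros t Ht. specialize (HT t Ht). destruct (H t) as [_ [_ [_ H1]]].
    apply Rmult_lt_0_compat; [apply exp_pos|lra].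
Qed.

Definition energy (a p : R) (y z : R -> R) (t : R) : R :=
  z t ^ 2 / 2 - a * (1 - a) * y t ^ 2 / 2 + ppow (p + 1) (y t) / (p + 1).

Lemma is_derive_ppow_comp (q : R) (y : R -> R) (t dy : R) :
  1 < q -> is_derive y t dy ->
  is_derive (fun t => ppow q (y t)) t (q * ppow (q - 1) (y t) * dy).
Proof.
  intros Hq Hy. evar_last.
  - apply (is_derive_comp (ppow q) y t _ _ (is_derive_ppow q (y t) Hq) Hy).
  - change (dy * (q * ppow (q - 1) (y t)) = q * ppow (q - 1) (y t) * dy). ring.
Qed.

Section Energy.

Variables (a p : R) (y z : R -> R).
Hypotheses (Ha : 0 < a < 1) (Hp : 1 < p) (Hyz : emden a p y z).

Lemma is_derive_energy (t : R) :
  is_derive (energy a p y z) t ((1 - 2 * a) * z t ^ 2).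
Proof.
  destruct (Hyz t) as [Hy Hz]. evar_last.
  - apply (is_derive_plus (fun t => z t ^ 2 / 2 - a * (1 - a) * y t ^ 2 / 2)
             (fun t => ppow (p + 1) (y t) / (p + 1))).
    + auto_derive; [|reflexivity].
      split; [eexists; exact Hz|split; [eexists; exact Hy|trivial]].
    + apply is_derive_ext with
        (f := fun t => / (p + 1) * ppow (p + 1) (y t)).
      * intros s. apply Rmult_comm.
      * apply (is_derive_scal (fun t => ppow (p + 1) (y t))).
        apply is_derive_ppow_comp; [lra|exact Hy].
  - change plus with Rplus.
    change (fun x => y x) with y. change (fun x => z x) with z.
    rewrite (is_derive_unique _ _ _ Hy), (is_derive_unique _ _ _ Hz).
    replace (p + 1 - 1) with p by ring. field. lra.
Qed.

Hypotheses (Hy0 : is_lim y m_infty 0) (Hz0 : is_lim z m_infty 0).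

Lemma is_lim_energy : is_lim (energy a p y z) m_infty 0.
Proof.
  assert (H1 : is_lim (fun t => ppow (p + 1) (y t)) m_infty 0).
  { rewrite <- (ppow_nonpos (p + 1) 0 (Rle_refl 0)).
    apply (filterlim_comp R R R y (ppow (p + 1)) (Rbar_locally m_infty)
             (locally 0)); [exact Hy0|].
    apply continuous_ppow. lra. }
  replace (Finite 0) with (Finite (/ 2 * (0 * 0) + - (a * (1 - a) / 2) * (0 * 0)
     + / (p + 1) * 0)) by (f_equal; ring).
  apply is_lim_ext with (f := fun t => / 2 * (z t * z t)
    + - (a * (1 - a) / 2) * (y t * y t) + / (p + 1) * ppow (p + 1) (y t)).
  { intros t. unfold energy. field. lra. }
  rewrite Rmult_0_r.
  apply is_lim_plus'; [apply is_lim_plus'|];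
    apply is_lim_scal_l with (l := Finite 0); trivial;
    now apply is_lim_m_infty_mult0.
Qed.

Hypothesis (Ha2 : 1 / 2 <= a).

Lemma energy_nonincreasing (s t : R) :
  s <= t -> energy a p y z t <= energy a p y z s.
Proof.
  intros Hst. apply derive_le0_ge with (f' := fun t => (1 - 2 * a) * z t ^ 2).
  - exact Hst.
  - intros; apply is_derive_energy.
  - intros r _. assert (H := pow2_ge_0 (z r)). nra.
Qed.

Lemma energy_nonpos (t : R) : energy a p y z t <= 0.
Proof.
  apply nonincreasing_le_lim with (f := energy a p y z)
    (f' := fun t => (1 - 2 * a) * z t ^ 2) (T := t).
  - intros; apply is_derive_energy.
  - intros r _. assert (H := pow2_ge_0 (z r)). nra.
  - apply is_lim_energy.
  - lra.
Qed.

Lemma emden_y_continuous : continuity y.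
Proof.
  intros t. apply continuity_pt_filterlim.
  apply (is_derive_continuous y t (z t)), Hyz.
Qed.

(* At a zero of [y] the nonpositive energy equals [z^2/2], so [z] vanishes as
   well: the concave function [u = x^a y(ln x)] would have a horizontal tangent
   at height 0, hence would be nonpositive. *)
Lemma emden_positive (T : R) :
  (forall t, t <= T -> 0 < y t) -> forall t, 0 < y t.
Proof.
  intros HT t1. apply Rnot_le_lt. intros H1.
  assert (HTt : T <= t1).
  { apply Rnot_lt_le. intros Hlt. specialize (HT t1 ltac:(lra)). lra. }
  destruct (IVT_gen y T t1 0 emden_y_continuous) as [t2 [Ht2 E2]].
  { assert (H2 := HT T ltac:(lra)).
    rewrite Rmin_right, Rmax_left; lra. }
  rewrite Rmin_left, Rmax_right in Ht2 by lra.
  assert (HE := energy_nonpos t2). unfold energy in HE.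
  rewrite E2, ppow_nonpos in HE by lra.
  assert (Hz2 : z t2 = 0) by nra.
  (* [U] is [u'] read in logarithmic time, and [e^(a t) y] is [u] itself. *)
  set (U := fun t => exp (- (1 - a) * t) * (z t + a * y t)).
  assert (HU : forall t, t <= t2 -> 0 <= U t).
  { intros t Ht. replace 0 with (U t2) by (unfold U; rewrite E2, Hz2; ring).
    apply derive_le0_ge with
      (f' := fun t => - exp (- (1 - a) * t) * ppow p (y t)); [exact Ht| |].
    - intros s _. now apply hQ_of_emden.
    - intros s _. assert (H2 := exp_pos (- (1 - a) * s)).
      assert (H3 := ppow_ge0 p (y s)). nra. }
  assert (HX : exp (a * T) * y T <= exp (a * t2) * y t2).
  { apply derive_ge0_le with (f := fun t => exp (a * t) * y t)
      (f' := fun t => exp (a * t) * (z t + a * y t)); [lra| |].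
    - intros s _. destruct (Hyz s) as [Hy _].
      auto_derive; [eexists; exact Hy|].
      change (fun x => y x) with y. rewrite (is_derive_unique _ _ _ Hy). ring.
    - intros s Hs. specialize (HU s ltac:(lra)). unfold U in HU.
      assert (H2 := exp_pos (- (1 - a) * s)). assert (H3 := exp_pos (a * s)).
      apply Rmult_le_pos; [lra|]. nra. }
  rewrite E2, Rmult_0_r in HX. specialize (HT T ltac:(lra)).
  assert (H3 := exp_pos (a * T)). nra.
Qed.

End Energy.

(** [L] is nonincreasing and bounded below, so from some time on it can drop by less than any
    prescribed [eta]. A late time with [P >= eps] would keep [P >= eps / 2] over a span [d], because
    [|P'| <= M], and force a drop of [g * (eps / 2) * d]. *)
Lemma barbalat (L L' P P' : R -> R) (g M lo : R) :
  0 < g -> 0 < M ->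
  (forall t, is_derive L t (L' t)) -> (forall t, L' t <= - g * P t) ->
  (forall t, lo <= L t) ->
  (forall t, is_derive P t (P' t)) -> (forall t, 0 <= P t) ->
  (forall t, Rabs (P' t) <= M) ->
  is_lim P p_infty 0.
Proof.
  intros Hg HM DL HL Hlo DP HP HP'.
  apply is_lim_p_infty_eps. intros eps He.
  (* Over a time [d], [P] changes by at most [M d = eps / 2]. *)
  set (d := eps / (2 * M)).
  assert (Hd : 0 < d) by (apply Rdiv_lt_0_compat; lra).
  destruct (completeness (fun r => exists t, r = - L t)) as [l [Hub Hlub]].
  { exists (- lo). intros r [t ->]. specialize (Hlo t). lra. }
  { now exists (- L 0), 0. }
  set (eta := g * (eps / 2) * d).
  assert (Heta : 0 < eta) by (apply Rmult_lt_0_compat; [nra|exact Hd]).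
  assert (HT : exists T, l - eta < - L T).
  { apply Classical_Prop.NNPP. intros Hn.
    assert (l <= l - eta); [|lra].
    apply Hlub. intros r [t ->]. apply Rnot_lt_le. intros Hlt.
    apply Hn. now exists t. }
  destruct HT as [T HT]. exists T. intros t Ht.
  rewrite Rminus_0_r, Rabs_pos_eq by apply HP.
  apply Rnot_le_lt. intros Hge.
  assert (LT : L t <= L T).
  { apply derive_le0_ge with (f' := L'); [lra|auto|].
    intros s _. specialize (HL s). specialize (HP s). nra. }
  assert (Lt : L (t + d) <= L t - eta).
  { destruct (mean_value L L' t (t + d) ltac:(lra) ltac:(auto)) as [c [Hc E]].
    replace (t + d - t) with d in E by ring.
    assert (HPc : eps / 2 <= P c).
    { destruct (mean_value P P' t c ltac:(lra) ltac:(auto)) as [c' [_ E']].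
      assert (H1 := HP' c'). apply Rabs_le_between in H1.
      assert (M * d = eps / 2) by (unfold d; field; lra). nra. }
    specialize (HL c).
    assert (L' c <= - g * (eps / 2)) by nra. unfold eta. nra. }
  assert (H1 : - L (t + d) <= l) by (apply Hub; now exists (t + d)).
  lra.
Qed.

(** * Convergence for [a > 1/2] *)

Lemma Rpower_inv_r (x q : R) : 0 < x -> q <> 0 -> Rpower (Rpower x q) (/ q) = x.
Proof.
  intros Hx Hq. rewrite Rpower_mult, Rinv_r, Rpower_1; auto.
Qed.

Lemma Rpower_split (x p : R) : 0 < x -> Rpower x p = x * Rpower x (p - 1).
Proof.
  intros Hx. rewrite <- (Rpower_1 x Hx) at 2. rewrite <- Rpower_plus.
  f_equal; ring.
Qed.

Section Convergence.

Variables (a p : R) (y z : R -> R).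
Hypotheses (Ha : 1 / 2 < a < 1) (Hp : 1 < p) (Hyz : emden a p y z).
Hypotheses (Hpos : forall t, 0 < y t).
Hypotheses (Hy0 : is_lim y m_infty 0) (Hz0 : is_lim z m_infty 0).

(** In this notation [z' = - b z - G] with damping [b > 0] and force [G = y^p - k y]; the positive
    equilibrium is [e = k]. *)
Let k : R := a * (1 - a).
Let b : R := 2 * a - 1.
Let e (t : R) : R := Rpower (y t) (p - 1).
Let G (t : R) : R := y t * (e t - k).

Lemma k_pos : 0 < k.
Proof. apply Rmult_lt_0_compat; lra. Qed.

Lemma e_pos (t : R) : 0 < e t.
Proof. apply Rpower_gt0. Qed.

Lemma energy_factor (t : R) :
  energy a p y z t = z t ^ 2 / 2 + y t ^ 2 * (e t / (p + 1) - k / 2).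
Proof.
  unfold energy, e, k. rewrite ppow_pos, (Rpower_split _ (p + 1)) by apply Hpos.
  replace (p + 1 - 1) with p by ring. rewrite (Rpower_split _ p) by apply Hpos.
  field. lra.
Qed.

Lemma energy_le0 (t : R) : energy a p y z t <= 0.
Proof. apply energy_nonpos; trivial; lra. Qed.

(** Nonpositive energy forces [y^2 (e / (p + 1) - k / 2) <= 0]; this confines the orbit to a bounded
    region. *)
Lemma e_bound (t : R) : e t <= k * (p + 1) / 2.
Proof.
  assert (H := energy_le0 t). rewrite energy_factor in H.
  apply Rnot_lt_le. intros Hlt. specialize (Hpos t).
  assert (0 < e t / (p + 1) - k / 2).
  { replace (e t / (p + 1) - k / 2) with ((e t - k * (p + 1) / 2) / (p + 1))
      by (field; lra). apply Rdiv_lt_0_compat; lra. }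
  assert (0 < y t ^ 2) by nra. nra.
Qed.

Lemma z_bound (t : R) : z t ^ 2 <= k * y t ^ 2.
Proof.
  assert (H := energy_le0 t). rewrite energy_factor in H.
  assert (0 <= y t ^ 2 * (e t / (p + 1))).
  { apply Rmult_le_pos; [apply pow2_ge_0|].
    left. apply Rdiv_lt_0_compat; [apply e_pos|lra]. }
  lra.
Qed.

Lemma y_bounded : exists Y, 0 < Y /\ forall t, y t <= Y.
Proof.
  assert (Hk := k_pos).
  exists (Rpower (k * (p + 1) / 2) (/ (p - 1))). split; [apply Rpower_gt0|].
  intros t. rewrite <- (Rpower_inv_r (y t) (p - 1)) by (trivial; lra).
  apply Rle_Rpower_l.
  - left. apply Rinv_0_lt_compat. lra.
  - split; [apply Rpower_gt0|apply e_bound].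
Qed.

Lemma is_derive_G (t : R) : is_derive G t ((p * e t - k) * z t).
Proof.
  destruct (Hyz t) as [Hy Hz].
  apply is_derive_ext with (f := fun t => ppow p (y t) - k * y t).
  { intros s. unfold G, e. rewrite ppow_pos, (Rpower_split _ p) by apply Hpos.
    match goal with |- ?x = ?y => change (@eq R x y) end. ring. }
  replace ((p * e t - k) * z t) with (p * ppow (p - 1) (y t) * z t - k * z t)
    by (unfold e; rewrite ppow_pos by apply Hpos; ring).
  apply (is_derive_minus (fun t => ppow p (y t)) (fun t => k * y t)).
  - now apply is_derive_ppow_comp.
  - now apply (is_derive_scal y).
Qed.

Lemma is_derive_z (t : R) : is_derive z t (- b * z t - G t).
Proof.
  destruct (Hyz t) as [Hy Hz].
  replace (- b * z t - G t) with
    ((1 - 2 * a) * z t + a * (1 - a) * y t - ppow p (y t)); [exact Hz|].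
  unfold b, G, e, k. rewrite ppow_pos, (Rpower_split _ p) by apply Hpos. ring.
Qed.

(** The dissipation [- b z^2] of the energy controls only [z]. The derivative of [z G] is
    [- b z G - G^2 + (p e - k) z^2], and its term [- G^2] supplies control of the force. *)
Lemma zG_to_0 : is_lim (fun t => z t ^ 2 + G t ^ 2) p_infty 0.
Proof.
  assert (Hk := k_pos). assert (Hb : 0 < b) by (unfold b; lra).
  destruct y_bounded as [Y [HY HyY]].
  set (B := k * (p + 1) / 2).
  assert (HB : 0 < B) by (unfold B; apply Rdiv_lt_0_compat; nra).
  set (M := p * B + k).
  assert (HM : 0 < M) by (unfold M; nra).
  assert (HMe : forall t, Rabs (p * e t - k) <= M).
  { intros t. assert (H1 := e_pos t). assert (H2 := e_bound t). fold B in H2.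
    apply Rabs_le. unfold M. nra. }
  (* By [- b z G <= G^2 / 2 + b^2 z^2 / 2] the cross term costs at most [d (M + b^2 / 2) z^2], less
     than half of [b z^2] for this [d]; what remains is at most [- (d / 2) (z^2 + G^2)]. *)
  set (d := b / (2 * M + b ^ 2 + 1)).
  assert (Hden : 0 < 2 * M + b ^ 2 + 1) by nra.
  assert (Hd : 0 < d) by (apply Rdiv_lt_0_compat; lra).
  assert (Hdb : d * (2 * M + b ^ 2 + 1) = b) by (unfold d; field; lra).
  assert (Hyb : forall t, y t ^ 2 <= Y ^ 2).
  { intros t. assert (H1 := Hpos t). specialize (HyY t). nra. }
  assert (Hzb : forall t, z t ^ 2 <= k * Y ^ 2).
  { intros t. eapply Rle_trans; [apply z_bound|].
    apply Rmult_le_compat_l; [lra|apply Hyb]. }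
  assert (HGb : forall t, G t ^ 2 <= Y ^ 2 * (B + k) ^ 2).
  { intros t. unfold G. rewrite Rpow_mult_distr.
    apply Rmult_le_compat; [apply pow2_ge_0|apply pow2_ge_0|apply Hyb|].
    assert (H1 := e_pos t). assert (H2 := e_bound t). fold B in H2. nra. }
  set (P := fun t => z t ^ 2 + G t ^ 2).
  set (Pm := k * Y ^ 2 + Y ^ 2 * (B + k) ^ 2).
  assert (HPm : forall t, P t <= Pm).
  { intros t. specialize (HGb t). specialize (Hzb t). unfold P, Pm. lra. }
  assert (Habs : forall t r, Rabs (r * (2 * (z t * G t))) <= Rabs r * P t).
  { intros t r. rewrite Rabs_mult. apply Rmult_le_compat_l; [apply Rabs_pos|].
    unfold P. apply Rabs_le.
    assert (H1 := pow2_ge_0 (z t - G t)). assert (H2 := pow2_ge_0 (z t + G t)).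
    lra. }
  assert (HP0 : forall t, 0 <= P t).
  { intros t. unfold P.
    assert (H1 := pow2_ge_0 (z t)). assert (H2 := pow2_ge_0 (G t)). lra. }
  apply barbalat with
    (L := fun t => energy a p y z t + d * (z t * G t))
    (L' := fun t => - b * z t ^ 2
       + d * ((- b * z t - G t) * G t + z t * ((p * e t - k) * z t)))
    (P' := fun t => 2 * z t * (- b * z t - G t) + 2 * G t * ((p * e t - k) * z t))
    (g := d / 2) (M := (2 * b + 1 + M) * (Pm + 1))
    (lo := - (k * Y ^ 2 / 2) - d * Pm).
  - lra.
  - assert (H1 := HPm 0). specialize (HP0 0). nra.
  - intros t.
    apply (is_derive_plus (energy a p y z) (fun t => d * (z t * G t))).
    + replace (- b) with (1 - 2 * a) by (unfold b; ring).
      apply is_derive_energy; trivial; lra.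
    + apply (is_derive_scal (fun t => z t * G t)).
      apply (is_derive_mult z G t _ _ (is_derive_z t) (is_derive_G t)).
      intros; apply Rmult_comm.
  - intros t. unfold P.
    assert (H1 : (p * e t - k) * z t ^ 2 <= M * z t ^ 2).
    { apply Rmult_le_compat_r; [apply pow2_ge_0|].
      eapply Rle_trans; [apply Rle_abs|apply HMe]. }
    assert (H2 : - b * z t * G t <= G t ^ 2 / 2 + b ^ 2 * z t ^ 2 / 2)
      by (assert (H2 := pow2_ge_0 (G t + b * z t)); lra).
    assert (H3 : (- b * z t - G t) * G t + z t * ((p * e t - k) * z t)
       <= - (G t ^ 2) / 2 + (M + b ^ 2 / 2) * z t ^ 2) by lra.
    apply Rmult_le_compat_l with (r := d) in H3; [|lra].
    assert (H4 : d * (2 * M + b ^ 2 + 1) * z t ^ 2 = b * z t ^ 2) by now rewrite Hdb.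
    assert (H5 := pow2_ge_0 (z t)).
    assert (H6 : 0 <= b * z t ^ 2) by (apply Rmult_le_pos; lra).
    lra.
  - intros t. assert (HE : - (k * Y ^ 2 / 2) <= energy a p y z t).
    { rewrite energy_factor. specialize (Hyb t).
      assert (0 <= y t ^ 2 * (e t / (p + 1))).
      { apply Rmult_le_pos; [apply pow2_ge_0|].
        left. apply Rdiv_lt_0_compat; [apply e_pos|lra]. }
      assert (H5 := pow2_ge_0 (z t)). nra. }
    assert (H1 : - P t <= z t * G t)
      by (assert (H1 := pow2_ge_0 (z t + G t)); assert (H2 := HP0 t);
          unfold P in *; lra).
    specialize (HPm t). nra.
  - intros t. apply is_derive_ext with (f := fun t => z t * z t + G t * G t).
    { intros s. change (z s * z s + G s * G s = z s ^ 2 + G s ^ 2). ring. }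
    assert (Dz := is_derive_z t). assert (DG := is_derive_G t).
    evar_last.
    + apply (is_derive_plus (fun t => z t * z t) (fun t => G t * G t)).
      * apply (is_derive_mult z z t _ _ Dz Dz). intros; apply Rmult_comm.
      * apply (is_derive_mult G G t _ _ DG DG). intros; apply Rmult_comm.
    + change plus with Rplus. change mult with Rmult. ring.
  - exact HP0.
  - intros t.
    replace (2 * z t * (- b * z t - G t) + 2 * G t * ((p * e t - k) * z t)) with
      (- 2 * b * z t ^ 2 + (-1) * (2 * (z t * G t))
       + (p * e t - k) * (2 * (z t * G t))) by ring.
    assert (H1 := Habs t (-1)). assert (H2 := Habs t (p * e t - k)).
    assert (H3 : Rabs (p * e t - k) * P t <= M * P t)
      by (apply Rmult_le_compat_r; trivial).
    replace (Rabs (-1)) with 1 in H1 by (rewrite Rabs_left; lra).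
    apply Rabs_le_between in H1.
    assert (H4 := Rle_trans _ _ _ H2 H3). apply Rabs_le_between in H4.
    assert (H5 : 0 <= b * z t ^ 2 <= b * P t) by (unfold P; split; nra).
    assert (H6 : (2 * b + 1 + M) * P t <= (2 * b + 1 + M) * (Pm + 1)).
    { apply Rmult_le_compat_l; [lra|]. specialize (HPm t). lra. }
    apply Rabs_le. lra.
Qed.

(** If the energy vanished identically, its derivative would give [z = 0] throughout, and [y] would
    be a positive constant that tends to 0 at -oo. *)
Lemma energy_neg_somewhere : exists t, energy a p y z t < 0.
Proof.
  apply Classical_Prop.NNPP. intros Hn.
  assert (E0 : forall t, energy a p y z t = 0).
  { intros t. apply Rle_antisym; [apply energy_le0|].
    apply Rnot_lt_le. intros Hlt. apply Hn. now exists t. }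
  assert (Z0 : forall t, z t = 0).
  { intros t.
    assert (H1 := is_derive_unique _ _ _
      (is_derive_energy a p y z ltac:(lra) Hp Hyz t)).
    rewrite (Derive_ext _ (fun _ => 0) t E0), Derive_const in H1.
    apply Rsqr_0_uniq. unfold Rsqr. nra. }
  destruct (proj1 (is_lim_m_infty_eps y 0) Hy0 (y 0) (Hpos 0)) as [T HT].
  set (s := Rmin T 0 - 1).
  assert (H1 := Rmin_l T 0). assert (H2 := Rmin_r T 0).
  specialize (HT s ltac:(unfold s; lra)). rewrite Rminus_0_r in HT.
  apply Rabs_def2 in HT.
  destruct (mean_value y z s 0 ltac:(unfold s; lra)) as [c [_ E]].
  - intros t _. apply Hyz.
  - rewrite Z0 in E. lra.
Qed.

(** A vanishing force [G = y (e - k)] leaves 0 and the positive equilibrium as candidates. Once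
    negative, the nonincreasing energy keeps [y] away from 0, and [G] may be divided by [y]. *)
Lemma unstable_converges :
  is_lim y p_infty (Rpower (a * (1 - a)) (/ (p - 1))).
Proof.
  fold k. assert (Hk := k_pos).
  destruct energy_neg_somewhere as [t0 H0].
  set (E0 := energy a p y z t0). fold E0 in H0.
  (* The lower bound comes from [- k y^2 / 2 <= E <= E0] after [t0]. *)
  set (y0 := sqrt (2 * - E0 / k)).
  assert (Hq : 0 < 2 * - E0 / k) by (apply Rdiv_lt_0_compat; lra).
  assert (Hy0' : 0 < y0) by (apply sqrt_lt_R0, Hq).
  assert (Hlow : forall t, t0 <= t -> y0 <= y t).
  { intros t Ht.
    assert (HE : energy a p y z t <= E0)
      by (apply energy_nonincreasing; trivial; lra).
    rewrite energy_factor in HE.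
    assert (0 <= y t ^ 2 * (e t / (p + 1))).
    { apply Rmult_le_pos; [apply pow2_ge_0|].
      left. apply Rdiv_lt_0_compat; [apply e_pos|lra]. }
    assert (H5 := pow2_ge_0 (z t)).
    assert (H6 : 2 * - E0 / k <= y t * y t).
    { apply Rmult_le_reg_r with k; [exact Hk|].
      replace (2 * - E0 / k * k) with (2 * - E0) by (field; lra). nra. }
    apply sqrt_le_1_alt in H6. rewrite sqrt_square in H6 by (left; apply Hpos).
    exact H6. }
  assert (He : is_lim e p_infty k).
  { apply is_lim_p_infty_eps. intros eps Heps.
    assert (Hye : 0 < y0 * eps) by nra.
    destruct (proj1 (is_lim_p_infty_eps _ 0) zG_to_0 ((y0 * eps) ^ 2))
      as [T HT]; [nra|].
    exists (Rmax t0 T). intros t Ht.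
    assert (H1 := Rmax_l t0 T). assert (H2 := Rmax_r t0 T).
    specialize (HT t ltac:(lra)). specialize (Hlow t ltac:(lra)).
    rewrite Rminus_0_r in HT. apply Rabs_def2 in HT.
    assert (H3 : G t ^ 2 < (y0 * eps) ^ 2)
      by (assert (H5 := pow2_ge_0 (z t)); lra).
    apply Rnot_le_lt. intros Hge.
    assert (H4 : y0 * eps <= Rabs (G t)).
    { unfold G. rewrite Rabs_mult, (Rabs_pos_eq (y t)) by lra.
      apply Rmult_le_compat; lra. }
    rewrite <- (pow2_abs (G t)) in H3. nra. }
  apply is_lim_ext with (f := fun t => Rpower (e t) (/ (p - 1))).
  { intros t. unfold e. apply Rpower_inv_r; [apply Hpos|lra]. }
  apply (filterlim_comp R R R e (fun x => Rpower x (/ (p - 1)))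
           (Rbar_locally p_infty) (locally k)); [exact He|].
  apply (is_derive_continuous (fun x => Rpower x (/ (p - 1))) k
    (/ (p - 1) * Rpower k (/ (p - 1) - 1))).
  apply is_derive_Reals, derivable_pt_lim_power, Hk.
Qed.

End Convergence.

(** * Uniqueness *)

Lemma exp_le (x y : R) : x <= y -> exp x <= exp y.
Proof.
  intros [H| ->]; [left; now apply exp_increasing|apply Rle_refl].
Qed.

(** * The slope of a positive solution at the origin *)

Section Asymptotics.

Variables (a p : R) (h Q : R -> R).
Hypotheses (Ha : 0 < a < 1) (Hp : 1 < p).
Let m : R := (p - 1) * (1 - a).
Hypotheses (Dh : forall t, is_derive h t (Q t - h t))
  (DQ : forall t, is_derive Q t (- exp (m * t) * ppow p (h t)))
  (Hpos : forall t, 0 < h t)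
  (Hy0 : is_lim (fun t => exp ((1 - a) * t) * h t) m_infty 0).

Lemma m_pos : 0 < m.
Proof. apply Rmult_lt_0_compat; lra. Qed.

Lemma ppow_h_pos (t : R) : 0 < ppow p (h t).
Proof. rewrite ppow_pos by apply Hpos. apply Rpower_gt0. Qed.

Lemma Q_nonincreasing (s t : R) : s <= t -> Q t <= Q s.
Proof.
  intros Hst.
  apply derive_le0_ge with (f' := fun t => - exp (m * t) * ppow p (h t)); auto.
  intros r _. assert (H1 := exp_pos (m * r)). assert (H2 := ppow_h_pos r). nra.
Qed.

Lemma is_derive_exp_h (c t : R) :
  is_derive (fun t => exp (c * t) * h t) t (exp (c * t) * (Q t + (c - 1) * h t)).
Proof.
  assert (H := Dh t). auto_derive; [eexists; exact H|].
  change (fun x => h x) with h. rewrite (is_derive_unique _ _ _ H). ring.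
Qed.

(** A concave function that is positive on a half-line cannot decrease: below a tangent of negative
    slope it would reach 0. *)
Lemma Q_positive (t : R) : 0 < Q t.
Proof.
  apply Rnot_le_lt. intros Hneg.
  (* [Q] is strictly decreasing, so one unit of time turns [Q t <= 0] into a strict inequality. *)
  assert (Hc : Q (t + 1) < 0).
  { destruct (mean_value Q (fun t => - exp (m * t) * ppow p (h t)) t (t + 1))
      as [c [_ E]]; [lra|auto|].
    assert (H1 := exp_pos (m * c)). assert (H2 := ppow_h_pos c). nra. }
  set (t1 := t + 1) in *. set (c := - Q t1).
  assert (Hcpos : 0 < c) by (unfold c; lra).
  (* With [c = - u'(x1)], the function [u + c x] is nonincreasing beyond [x1]; if [K] is its value
     at [x1], then [u <= 0] at [x = K / c]. *)
  assert (H1 : forall s, t1 <= s ->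
    exp (1 * s) * h s + c * exp s <= exp (1 * t1) * h t1 + c * exp t1).
  { intros s Hs. apply derive_le0_ge with
      (f := fun s => exp (1 * s) * h s + c * exp s)
      (f' := fun s => exp (1 * s) * (Q s + (1 - 1) * h s) + c * exp s);
      [exact Hs| |].
    - intros r _. apply (is_derive_plus (fun s => exp (1 * s) * h s)).
      + apply is_derive_exp_h.
      + apply (is_derive_scal exp), is_derive_exp.
    - intros r Hr. rewrite Rmult_1_l.
      assert (H2 := Q_nonincreasing t1 r ltac:(lra)). assert (H3 := exp_pos r).
      unfold c. nra. }
  set (K := exp (1 * t1) * h t1 + c * exp t1).
  assert (HU : 0 < exp (1 * t1) * h t1)
    by (apply Rmult_lt_0_compat; [apply exp_pos|apply Hpos]).
  assert (HK : exp t1 <= K / c).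
  { apply Rmult_le_reg_r with c; [exact Hcpos|].
    replace (K / c * c) with K by (field; lra). unfold K. lra. }
  assert (HK0 := exp_pos t1).
  assert (Hs : t1 <= ln (K / c)).
  { rewrite <- (ln_exp t1). apply ln_le; lra. }
  specialize (H1 _ Hs). rewrite (exp_ln (K / c)) in H1 by lra.
  assert (H2 : 0 < exp (1 * ln (K / c)) * h (ln (K / c)))
    by (apply Rmult_lt_0_compat; [apply exp_pos|apply Hpos]).
  fold K in H1. replace (c * (K / c)) with K in H1 by (field; lra). lra.
Qed.

(** [e^t (h - Q) = u - x u'] is the height at which the tangent of [u] at [x] meets the axis
    [x = 0]. *)
Lemma is_derive_D (t : R) :
  is_derive (fun t => exp t * (h t - Q t)) t
    (exp ((1 + m) * t) * ppow p (h t)).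
Proof.
  assert (H1 := Dh t). assert (H2 := DQ t).
  auto_derive; [split; [eexists; exact H1|split; [eexists; exact H2|trivial]]|].
  change (fun x => h x) with h. change (fun x => Q x) with Q.
  rewrite (is_derive_unique _ _ _ H1), (is_derive_unique _ _ _ H2).
  replace (exp ((1 + m) * t)) with (exp t * exp (m * t))
    by (rewrite <- exp_plus; f_equal; ring). ring.
Qed.

(** If a tangent met the axis at height [- c < 0], so would all earlier ones, at or below that
    height; then [du/dt = x u' >= c] at all earlier times and [u] would have vanished in the
    past. *)
Lemma Q_le_h (t : R) : Q t <= h t.
Proof.
  apply Rnot_lt_le. intros Hlt.
  set (c := exp t * (Q t - h t)).
  assert (Hc : 0 < c) by (apply Rmult_lt_0_compat; [apply exp_pos|lra]).
  assert (H1 : forall s, s <= t -> c <= exp s * (Q s - h s)).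
  { intros s Hs.
    assert (exp s * (h s - Q s) <= exp t * (h t - Q t)); [|unfold c; nra].
    apply derive_ge0_le with (f := fun s => exp s * (h s - Q s))
      (f' := fun t => exp ((1 + m) * t) * ppow p (h t)); [exact Hs| |].
    - intros; apply is_derive_D.
    - intros r _. apply Rmult_le_pos; [left; apply exp_pos|apply ppow_ge0]. }
  set (U := fun s => exp (1 * s) * h s).
  assert (HU : forall s, 0 < U s)
    by (intro; apply Rmult_lt_0_compat; [apply exp_pos|apply Hpos]).
  (* Going back by [U t / c] at rate at least [c] uses up the whole value [U t]. *)
  set (s := t - U t / c).
  assert (Hs : s <= t)
    by (unfold s; assert (0 < U t / c) by (apply Rdiv_lt_0_compat; auto); lra).
  destruct (mean_value U (fun s => exp (1 * s) * (Q s + (1 - 1) * h s)) s t Hs)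
    as [r [Hr E]].
  { intros; apply is_derive_exp_h. }
  specialize (H1 r ltac:(lra)). specialize (HU s).
  assert (HUr : 0 < exp r * h r)
    by (apply Rmult_lt_0_compat; [apply exp_pos|apply Hpos]).
  rewrite Rmult_1_l in E. replace (t - s) with (U t / c) in E by (unfold s; ring).
  assert (c * (U t / c) <= exp r * (Q r + (1 - 1) * h r) * (U t / c)).
  { apply Rmult_le_compat_r; [unfold s in Hs; lra|lra]. }
  replace (c * (U t / c)) with (U t) in H by (field; lra). lra.
Qed.

(* [W] is the Wronskian of [u] and [x^s], where [u = e^t h] and [x = e^t]; it
   is increasing near 0 because [x^2 u'' = - o(1) u]. *)
Lemma Q_ge_near_m_infty (s : R) :
  1 - a <= s < 1 -> exists T, forall t, t <= T -> s * h t <= Q t.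
Proof.
  intros Hs.
  assert (Hss : 0 < s * (1 - s)) by (apply Rmult_lt_0_compat; lra).
  (* Below this threshold [y^(p-1) < s (1 - s)], which makes the derivative of the Wronskian
     nonnegative. *)
  destruct (proj1 (is_lim_m_infty_eps _ _) Hy0 (Rpower (s * (1 - s)) (/ (p - 1)))
              (Rpower_gt0 _ _)) as [T HT].
  exists (Rmin T 0 - 1). intros t Ht.
  assert (HT1 := Rmin_l T 0). assert (HT2 := Rmin_r T 0).
  assert (HW : 0 <= exp (s * t) * (Q t - s * h t)).
  { apply nondecreasing_ge_lim with
      (f := fun t => exp (s * t) * (Q t - s * h t))
      (f' := fun t => exp (s * t) *
               (s * (1 - s) * h t - exp (m * t) * ppow p (h t)))
      (T := Rmin T 0 - 1); [| | |exact Ht].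
    - intros r _. assert (H1 := Dh r). assert (H2 := DQ r).
      auto_derive; [split; [eexists; exact H2|split; [eexists; exact H1|trivial]]|].
      change (fun x => h x) with h. change (fun x => Q x) with Q.
      rewrite (is_derive_unique _ _ _ H1), (is_derive_unique _ _ _ H2). ring.
    - intros r Hr. specialize (HT r ltac:(lra)).
      rewrite Rminus_0_r in HT. apply Rabs_def2 in HT. destruct HT as [HT _].
      apply Rmult_le_pos; [left; apply exp_pos|].
      assert (Hy : 0 < exp ((1 - a) * r) * h r)
        by (apply Rmult_lt_0_compat; [apply exp_pos|apply Hpos]).
      assert (Hp1 : 0 < p - 1) by lra.
      apply (fun H => Rlt_Rpower_l _ _ (p - 1) Hp1 (conj Hy H)) in HT.
      rewrite Rpower_mult, Rinv_l, Rpower_1 in HT by lra.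
      rewrite ppow_pos, (Rpower_split _ p) by apply Hpos.
      rewrite <- Rpower_mult_distr in HT by (apply exp_pos || apply Hpos).
      unfold Rpower at 1 in HT. rewrite ln_exp in HT.
      replace ((p - 1) * ((1 - a) * r)) with (m * r) in HT by (unfold m; ring).
      assert (H1 := Hpos r). nra.
    (* For [s >= 1 - a] and [t <= 0] the Wronskian is dominated by [y], hence starts from 0 at
       -oo. *)
    - apply is_lim_m_infty_squeeze0 with
        (g := fun t => exp ((1 - a) * t) * h t) (T := 0); [|exact Hy0].
      intros r Hr. rewrite Rabs_mult, Rabs_pos_eq by (left; apply exp_pos).
      assert (H1 := Q_positive r). assert (H2 := Q_le_h r).
      assert (H3 := Hpos r).
      apply Rmult_le_compat; [left; apply exp_pos|apply Rabs_pos| |].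
      + apply exp_le. nra.
      + apply Rabs_le. nra. }
  assert (H1 := exp_pos (s * t)).
  apply Rnot_lt_le. intros Hlt. nra.
Qed.

(** The bound [s h <= Q] with [s = 1 - d] makes [e^(d t) h] nondecreasing, so [h <= C e^(-d t)] near
    -oo. For small [d] the forcing [e^(m t) h^p] is then integrable at -oo, and the monotone [Q]
    stays bounded. *)
Lemma slope_at_m_infty :
  exists A, 0 < A /\ is_lim Q m_infty A /\
    is_lim (fun t => h t - Q t) m_infty 0 /\ forall t, h t <= A.
Proof.
  assert (Hm := m_pos).
  (* [d <= a] allows [s = 1 - d] in [Q_ge_near_m_infty]; [p d <= m / 2] leaves a positive decay rate
     [kap = m - p d]. *)
  set (d := Rmin a (m / (2 * p))).
  assert (Hd1 : d <= a) by apply Rmin_l.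
  assert (Hd2 : d * (2 * p) <= m).
  { replace m with (m / (2 * p) * (2 * p)) by (field; lra).
    apply Rmult_le_compat_r; [lra|apply Rmin_r]. }
  assert (Hd0 : 0 < d) by (apply Rmin_pos; [lra|apply Rdiv_lt_0_compat; lra]).
  set (kap := m - p * d).
  assert (Hkap : 0 < kap) by (unfold kap; nra).
  destruct (Q_ge_near_m_infty (1 - d)) as [T HT]; [lra|].
  set (C := exp (d * T) * h T).
  assert (HC : 0 < C)
    by (apply Rmult_lt_0_compat; [apply exp_pos|apply Hpos]).
  assert (Hh : forall t, t <= T -> exp (d * t) * h t <= C).
  { intros t Ht. apply derive_ge0_le with (f := fun t => exp (d * t) * h t)
      (f' := fun t => exp (d * t) * (Q t + (d - 1) * h t)); [exact Ht| |].
    - intros; apply is_derive_exp_h.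
    - intros r Hr. specialize (HT r ltac:(lra)).
      apply Rmult_le_pos; [left; apply exp_pos|lra]. }
  set (C' := ppow p C).
  assert (HC' : 0 <= C') by apply ppow_ge0.
  assert (Hpp : forall t, t <= T ->
            exp (m * t) * ppow p (h t) <= C' * exp (kap * t)).
  { intros t Ht.
    assert (H1 := ppow_le p _ _ ltac:(lra) (Hh t Ht)).
    rewrite ppow_mult_exp in H1. fold C' in H1.
    replace (exp (m * t)) with (exp (p * (d * t)) * exp (kap * t))
      by (rewrite <- exp_plus; f_equal; unfold kap; ring).
    assert (H2 := exp_pos (kap * t)). nra. }
  assert (Dexp : forall c t, 0 < c ->
            is_derive (fun t => C' / c * exp (c * t)) t (C' * exp (c * t))).
  { intros c t Hc. auto_derive; [trivial|field; lra]. }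
  assert (HQub : forall t, Q t <= Q T + C' / kap * exp (kap * T)).
  { intros t. assert (Hkc : 0 <= C' / kap)
      by (apply Rmult_le_pos; [exact HC'|left; now apply Rinv_0_lt_compat]).
    destruct (Rle_lt_dec t T) as [Ht|Ht].
    - assert (H1 : Q t + C' / kap * exp (kap * t)
                   <= Q T + C' / kap * exp (kap * T)).
      { apply derive_ge0_le with (f := fun t => Q t + C' / kap * exp (kap * t))
          (f' := fun t => - exp (m * t) * ppow p (h t) + C' * exp (kap * t));
          [exact Ht| |].
        - intros r _. apply (is_derive_plus Q); [apply DQ|now apply Dexp].
        - intros r Hr. specialize (Hpp r ltac:(lra)). lra. }
      assert (H2 := exp_pos (kap * t)). nra.
    - assert (H1 := Q_nonincreasing T t ltac:(lra)).
      assert (H2 := exp_pos (kap * T)). nra. }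
  destruct (completeness (fun r => exists t, r = Q t)) as [A [Hub Hlub]].
  { eexists. intros r [t ->]. apply HQub. }
  { now exists (Q 0), 0. }
  assert (HQA : forall t, Q t <= A) by (intros t; apply Hub; now exists t).
  assert (LQ : is_lim Q m_infty A).
  { apply is_lim_m_infty_eps. intros eps He.
    assert (HS : exists S, A - eps < Q S).
    { apply Classical_Prop.NNPP. intros Hn.
      assert (A <= A - eps); [|lra].
      apply Hlub. intros r [t ->]. apply Rnot_lt_le. intros Hlt.
      apply Hn. now exists t. }
    destruct HS as [S HS]. exists S. intros t Ht.
    assert (H1 := Q_nonincreasing t S ltac:(lra)). specialize (HQA t).
    apply Rabs_def1; lra. }
  (* This is the initial value at -oo needed to integrate [is_derive_D]; dividing the result by
     [e^t] gives [h - Q <= C' / (1 + kap) * e^(kap t)]. *)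
  assert (LD : is_lim (fun t => exp t * (h t - Q t)) m_infty 0).
  { apply is_lim_m_infty_squeeze0 with
      (g := fun t => exp ((1 - a) * t) * h t) (T := 0); [|exact Hy0].
    intros t Ht. rewrite Rabs_mult, Rabs_pos_eq by (left; apply exp_pos).
    assert (H1 := Q_positive t). assert (H2 := Q_le_h t).
    apply Rmult_le_compat; [left; apply exp_pos|apply Rabs_pos| |].
    - apply exp_le. nra.
    - apply Rabs_le. lra. }
  assert (Lv : is_lim (fun t => h t - Q t) m_infty 0).
  { apply is_lim_m_infty_squeeze0 with
      (g := fun t => C' / (1 + kap) * exp (kap * t)) (T := T).
    - intros t Ht. rewrite Rabs_pos_eq by (assert (H := Q_le_h t); lra).
      assert (H1 : 0 <= C' / (1 + kap) * exp ((1 + kap) * t)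
                        - exp t * (h t - Q t)).
      { apply nondecreasing_ge_lim with
          (f := fun t => C' / (1 + kap) * exp ((1 + kap) * t)
                         - exp t * (h t - Q t))
          (f' := fun t => C' * exp ((1 + kap) * t)
                          - exp ((1 + m) * t) * ppow p (h t))
          (T := T); [| | |exact Ht].
        - intros r _. apply (is_derive_minus
            (fun t => C' / (1 + kap) * exp ((1 + kap) * t))
            (fun t => exp t * (h t - Q t))).
          + apply Dexp; lra.
          + apply is_derive_D.
        - intros r Hr. specialize (Hpp r Hr). assert (H1 := exp_pos r).
          replace (exp ((1 + m) * r)) with (exp r * exp (m * r))
            by (rewrite <- exp_plus; f_equal; ring).
          replace (exp ((1 + kap) * r)) with (exp r * exp (kap * r))
            by (rewrite <- exp_plus; f_equal; ring).
          nra.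
        - replace 0 with (C' / (1 + kap) * 0 - 0) by ring.
          apply (is_lim_minus' (fun t => C' / (1 + kap) * exp ((1 + kap) * t))
                   (fun t => exp t * (h t - Q t)));
            [|exact LD].
          apply is_lim_scal_l with (l := Finite 0).
          apply is_lim_exp_scal_m_infty. lra. }
      assert (H2 := exp_pos t).
      apply Rmult_le_reg_l with (exp t); [exact H2|].
      replace (exp ((1 + kap) * t)) with (exp t * exp (kap * t)) in H1
        by (rewrite <- exp_plus; f_equal; ring).
      lra.
    - replace 0 with (C' / (1 + kap) * 0) by ring.
      apply is_lim_scal_l with (l := Finite 0).
      now apply is_lim_exp_scal_m_infty. }
  exists A. split; [|split; [exact LQ|split; [exact Lv|]]].
  - assert (H1 := HQA 0). assert (H2 := Q_positive 0). lra.
  - intros t. apply nonincreasing_le_lim with (f := h)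
      (f' := fun t => Q t - h t) (T := t); [auto| | |lra].
    + intros r _. assert (H1 := Q_le_h r). lra.
    + apply is_lim_ext with (f := fun t => Q t + (h t - Q t)).
      * intros r. ring.
      * replace A with (A + 0) by ring. now apply is_lim_plus'.
Qed.

End Asymptotics.

(* Gronwall for [N = (Q1 - Q2)^2 + (v1 - v2)^2] with [vi = hi - Qi]; in these
   variables the linear part of the system only decreases [N]. *)
Lemma hQ_unique (p m A : R) (h1 Q1 h2 Q2 : R -> R) :
  1 < p -> 0 < m -> 0 < A ->
  (forall t, is_derive h1 t (Q1 t - h1 t)) ->
  (forall t, is_derive Q1 t (- exp (m * t) * ppow p (h1 t))) ->
  (forall t, is_derive h2 t (Q2 t - h2 t)) ->
  (forall t, is_derive Q2 t (- exp (m * t) * ppow p (h2 t))) ->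
  (forall t, h1 t <= A) -> (forall t, h2 t <= A) ->
  is_lim Q1 m_infty A -> is_lim Q2 m_infty A ->
  is_lim (fun t => h1 t - Q1 t) m_infty 0 ->
  is_lim (fun t => h2 t - Q2 t) m_infty 0 ->
  forall t, h1 t = h2 t.
Proof.
  intros Hp Hm HA Dh1 DQ1 Dh2 DQ2 B1 B2 LQ1 LQ2 Lv1 Lv2 t.
  set (q := fun t => Q1 t - Q2 t).
  set (v := fun t => (h1 t - Q1 t) - (h2 t - Q2 t)).
  set (f := fun t => exp (m * t) * (ppow p (h1 t) - ppow p (h2 t))).
  set (L := p * Rpower A (p - 1)).
  assert (HL : 0 < L) by (apply Rmult_lt_0_compat; [lra|apply Rpower_gt0]).
  assert (Dq : forall t, is_derive q t (- f t)).
  { intros s. replace (- f s) with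
      (- exp (m * s) * ppow p (h1 s) - - exp (m * s) * ppow p (h2 s))
      by (unfold f; ring).
    now apply (is_derive_minus Q1 Q2). }
  assert (Dv : forall t, is_derive v t (- v t + f t)).
  { intros s. replace (- v s + f s) with
      ((Q1 s - h1 s - - exp (m * s) * ppow p (h1 s))
       - (Q2 s - h2 s - - exp (m * s) * ppow p (h2 s)))
      by (unfold f, v; ring).
    apply (is_derive_minus (fun t => h1 t - Q1 t) (fun t => h2 t - Q2 t)).
    - now apply (is_derive_minus h1 Q1).
    - now apply (is_derive_minus h2 Q2). }
  assert (Bf : forall t,
    Rabs (f t) <= exp (m * t) * (L * (Rabs (q t) + Rabs (v t)))).
  { intros s. unfold f. rewrite Rabs_mult, Rabs_pos_eq by (left; apply exp_pos).
    apply Rmult_le_compat_l; [left; apply exp_pos|].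
    eapply Rle_trans; [now apply ppow_lipschitz with (A := A)|].
    fold L. apply Rmult_le_compat_l; [lra|].
    replace (h1 s - h2 s) with (q s + v s) by (unfold q, v; ring).
    apply Rabs_triang. }
  (* Integrating factor for the rate [4 L e^(m t)], which comes from [2 (|q| + |v|) |f| <= 2 L e^(m
     t) (|q| + |v|)^2]. The rate is integrable at -oo, so [g] tends to 1 there and the initial value
     of [N] is 0. *)
  set (g := fun t => exp (- (4 * L / m) * exp (m * t))).
  set (N := fun t => (q t * q t + v t * v t) * g t).
  assert (HN : N t <= 0).
  { apply nonincreasing_le_lim with (f := N)
      (f' := fun t => (2 * q t * (- f t) + 2 * v t * (- v t + f t)
         - 4 * L * exp (m * t) * (q t * q t + v t * v t)) * g t) (T := t);
      [| | |lra].
    - intros s _.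
      assert (Dg : is_derive g s (- (4 * L) * exp (m * s) * g s)).
      { unfold g. auto_derive; [trivial|]. field. lra. }
      evar_last.
      + apply (is_derive_mult (fun t => q t * q t + v t * v t) g s
          (2 * q s * (- f s) + 2 * v s * (- v s + f s))
          (- (4 * L) * exp (m * s) * g s)); [|exact Dg|intros; apply Rmult_comm].
        evar_last.
        * apply (is_derive_plus (fun t => q t * q t) (fun t => v t * v t)).
          -- apply (is_derive_mult q q s _ _ (Dq s) (Dq s)).
             intros; apply Rmult_comm.
          -- apply (is_derive_mult v v s _ _ (Dv s) (Dv s)).
             intros; apply Rmult_comm.
        * change plus with Rplus. change mult with Rmult. ring.
      + change plus with Rplus. change mult with Rmult. cbv beta. ring.
    - intros s _.
      assert (Hg : 0 < g s) by apply exp_pos.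
      assert (Hle : 2 * q s * - f s + 2 * v s * (- v s + f s)
                <= 4 * L * exp (m * s) * (q s * q s + v s * v s)).
      { assert (H1 := Bf s). set (X := Rabs (q s)) in *. set (Y := Rabs (v s)) in *.
        assert (HX : q s * q s = X * X)
          by (unfold X; rewrite <- Rabs_mult, Rabs_pos_eq;
              [ring|exact (Rle_0_sqr (q s))]).
        assert (HY : v s * v s = Y * Y)
          by (unfold Y; rewrite <- Rabs_mult, Rabs_pos_eq;
              [ring|exact (Rle_0_sqr (v s))]).
        assert (HX0 : 0 <= X) by apply Rabs_pos.
        assert (HY0 : 0 <= Y) by apply Rabs_pos.
        assert (H2 : - (q s * f s) <= X * Rabs (f s)).
        { unfold X. rewrite <- Rabs_mult, <- Rabs_Ropp. apply Rle_abs. }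
        assert (H3 : v s * f s <= Y * Rabs (f s)).
        { unfold Y. rewrite <- Rabs_mult. apply Rle_abs. }
        assert (H4 : (X + Y) * Rabs (f s) <= (X + Y) * (exp (m * s) * (L * (X + Y))))
          by (apply Rmult_le_compat_l; [lra|exact H1]).
        assert (H5 : 0 <= exp (m * s) * L * ((X - Y) * (X - Y))).
        { apply Rmult_le_pos; [|exact (Rle_0_sqr (X - Y))].
          apply Rmult_le_pos; [left; apply exp_pos|lra]. }
        rewrite HX, HY. nra. }
      nra.
    - assert (Lq0 : is_lim q m_infty 0).
      { replace 0 with (A - A) by ring. now apply is_lim_minus'. }
      assert (Lv0 : is_lim v m_infty 0).
      { replace 0 with (0 - 0) by ring. now apply is_lim_minus'. }
      apply is_lim_m_infty_squeeze0 with
        (g := fun t => q t * q t + v t * v t) (T := 0).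
      + intros s _. unfold N. rewrite Rabs_pos_eq.
        * assert (H1 : g s <= 1).
          { rewrite <- exp_0. apply exp_le.
            assert (H2 := exp_pos (m * s)).
            assert (0 < 4 * L / m) by (apply Rdiv_lt_0_compat; lra). nra. }
          rewrite <- (Rmult_1_r (_ + _)) at 2.
          apply Rmult_le_compat_l; [nra|exact H1].
        * apply Rmult_le_pos; [nra|left; apply exp_pos].
      + replace (Finite 0) with (Finite (0 + 0)) by (f_equal; ring).
        apply is_lim_plus'; now apply is_lim_m_infty_mult0. }
  unfold N in HN. assert (Hg : 0 < g t) by apply exp_pos.
  assert (HN2 : q t * q t + v t * v t <= 0)
    by (apply Rnot_lt_le; intros Hlt; nra).
  assert (Eq : q t = 0) by nra. assert (Ev : v t = 0) by nra.
  unfold q, v in *. lra.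
Qed.

Lemma emden_unique (a p : R) (y1 z1 y2 z2 : R -> R) :
  0 < a < 1 -> 1 < p -> emden a p y1 z1 -> emden a p y2 z2 ->
  (forall t, 0 < y1 t) -> (forall t, 0 < y2 t) ->
  is_lim y1 m_infty 0 -> is_lim y2 m_infty 0 ->
  exists tau, forall t, y2 t = y1 (t + tau).
Proof.
  intros Ha Hp E1 E2 P1 P2 L1 L2.
  set (m := (p - 1) * (1 - a)).
  assert (Hm : 0 < m) by (apply Rmult_lt_0_compat; lra).
  set (H := fun (y : R -> R) t => exp (- (1 - a) * t) * y t).
  set (Q := fun (y z : R -> R) t => exp (- (1 - a) * t) * (z t + a * y t)).
  assert (Hsys : forall y z, emden a p y z -> forall t,
    is_derive (H y) t (Q y z t - H y t) /\
    is_derive (Q y z) t (- exp (m * t) * ppow p (H y t))).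
  { intros y z E t. destruct (hQ_of_emden a p y z E t) as [D1 D2].
    split; [exact D1|].
    replace (- exp (m * t) * ppow p (H y t)) with
      (- exp (- (1 - a) * t) * ppow p (y t)); [exact D2|].
    unfold H. rewrite ppow_mult_exp.
    replace (exp (- (1 - a) * t)) with (exp (m * t) * exp (p * (- (1 - a) * t)))
      by (rewrite <- exp_plus; f_equal; unfold m; ring). ring. }
  assert (Hback : forall (y : R -> R) t, exp ((1 - a) * t) * H y t = y t).
  { intros y t. unfold H. rewrite <- Rmult_assoc, <- exp_plus.
    replace ((1 - a) * t + - (1 - a) * t) with 0 by ring. rewrite exp_0. ring. }
  assert (Hslope : forall y z, emden a p y z -> (forall t, 0 < y t) ->
    is_lim y m_infty 0 ->
    exists A, 0 < A /\ is_lim (Q y z) m_infty A /\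
      is_lim (fun t => H y t - Q y z t) m_infty 0 /\ forall t, H y t <= A).
  { intros y z E P L. apply slope_at_m_infty with (a := a) (p := p); trivial.
    - intros; now apply Hsys.
    - intros t. now destruct (Hsys y z E t).
    - intros; apply Rmult_lt_0_compat; [apply exp_pos|apply P].
    - apply is_lim_ext with (f := y); [|exact L].
      intros t. symmetry. apply Hback. }
  destruct (Hslope y1 z1 E1 P1 L1) as [A1 [HA1 [LQ1 [Lv1 B1]]]].
  destruct (Hslope y2 z2 E2 P2 L2) as [A2 [HA2 [LQ2 [Lv2 B2]]]].
  (* Translation by [tau] multiplies the slope at the origin by [e^((1-a) tau)]; this choice turns
     [A1] into [A2]. *)
  set (tau := ln (A2 / A1) / (1 - a)).
  set (c := exp ((1 - a) * tau)).
  assert (Hc : c * A1 = A2).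
  { unfold c, tau. replace ((1 - a) * (ln (A2 / A1) / (1 - a))) with (ln (A2 / A1))
      by (field; lra).
    rewrite exp_ln by (apply Rdiv_lt_0_compat; lra). field. lra. }
  assert (Hc0 : 0 < c) by apply exp_pos.
  set (y3 := fun t => y1 (t + tau)). set (z3 := fun t => z1 (t + tau)).
  assert (Dt : forall t, is_derive (fun t => t + tau) t 1)
    by (intros; auto_derive; [trivial|ring]).
  assert (E3 : emden a p y3 z3).
  { intros t. destruct (E1 (t + tau)) as [D1 D2]. split.
    - rewrite <- (Rmult_1_l (z3 t)).
      apply (is_derive_comp y1 (fun t => t + tau) t _ _ D1 (Dt t)).
    - rewrite <- (Rmult_1_l (_ - _)).
      apply (is_derive_comp z1 (fun t => t + tau) t _ _ D2 (Dt t)). }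
  assert (Hsh : forall t, exp (- (1 - a) * t) = c * exp (- (1 - a) * (t + tau))).
  { intros t. unfold c. rewrite <- exp_plus. f_equal. ring. }
  assert (Lsh : forall (f : R -> R) (l : R), is_lim f m_infty l ->
    is_lim (fun t => c * f (t + tau)) m_infty (c * l)).
  { intros f l Hf. apply is_lim_scal_l with (l := Finite l).
    apply is_lim_m_infty_eps. intros eps He.
    destruct (proj1 (is_lim_m_infty_eps _ _) Hf eps He) as [T HT].
    exists (T - tau). intros t Ht. apply HT. lra. }
  assert (EH : forall t, H y3 t = H y2 t).
  { apply hQ_unique with (p := p) (m := m) (A := A2) (Q1 := Q y3 z3) (Q2 := Q y2 z2);
      trivial.
    - intros t. now destruct (Hsys y3 z3 E3 t).
    - intros t. now destruct (Hsys y3 z3 E3 t).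
    - intros t. now destruct (Hsys y2 z2 E2 t).
    - intros t. now destruct (Hsys y2 z2 E2 t).
    - intros t. unfold H. rewrite Hsh, <- Hc, Rmult_assoc.
      apply Rmult_le_compat_l; [lra|apply B1].
    - rewrite <- Hc. apply is_lim_ext with (f := fun t => c * Q y1 z1 (t + tau)).
      + intros t. unfold Q. rewrite (Hsh t). unfold y3, z3. ring.
      + now apply Lsh.
    - replace 0 with (c * 0) by ring.
      apply is_lim_ext with
        (f := fun t => c * (H y1 (t + tau) - Q y1 z1 (t + tau))).
      + intros t. unfold H, Q. rewrite (Hsh t). unfold y3, z3. ring.
      + apply (Lsh (fun t => H y1 t - Q y1 z1 t)), Lv1. }
  exists tau. intros t. rewrite <- Hback, <- EH. apply (Hback y3).
Qed.

(** * From the autonomous equation back to [u] *)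

Lemma emden_reverse (a p : R) (y z : R -> R) :
  emden a p y z -> emden (1 - a) p (fun t => y (- t)) (fun t => - z (- t)).
Proof.
  intros H t. destruct (H (- t)) as [Dy Dz].
  assert (Dt : is_derive (fun t => - t) t (-1)) by (auto_derive; [trivial|ring]).
  split; evar_last.
  - apply (is_derive_comp y Ropp t _ _ Dy Dt).
  - change (-1 * z (- t) = - z (- t)). ring.
  - apply (is_derive_opp (fun t => z (- t))).
    apply (is_derive_comp z Ropp t _ _ Dz Dt).
  - change (- (-1 * ((1 - 2 * a) * z (- t) + a * (1 - a) * y (- t) - ppow p (y (- t))))
      = (1 - 2 * (1 - a)) * - z (- t) + (1 - a) * (1 - (1 - a)) * y (- t)
        - ppow p (y (- t))).
    ring.
Qed.

(** Limits are imposed on [y] alone, in accordance with [asym], which does not involve [u']. *)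
Definition emden_orbit (a p l0 linf : R) (y : R -> R) : Prop :=
  (exists z, emden a p y z) /\ (forall t, 0 < y t) /\
  is_lim y m_infty l0 /\ is_lim y p_infty linf.

Lemma emden_orbit_reverse (a p l0 linf : R) (y : R -> R) :
  emden_orbit a p l0 linf y -> emden_orbit (1 - a) p linf l0 (fun t => y (- t)).
Proof.
  intros [[z E] [P [L0 Linf]]]. split; [|split; [|split]].
  - eexists. now apply emden_reverse with (z := z).
  - intros t. apply P.
  - apply is_lim_opp_arg. apply is_lim_ext with (f := y); [|exact Linf].
    intros t. now rewrite Ropp_involutive.
  - now apply (is_lim_opp_arg y).
Qed.

Lemma emden_orbit_unique (a p linf : R) (y1 y2 : R -> R) :
  0 < a < 1 -> 1 < p -> emden_orbit a p 0 linf y1 -> emden_orbit a p 0 linf y2 ->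
  exists tau, forall t, y2 t = y1 (t + tau).
Proof.
  intros Ha Hp [[z1 E1] [P1 [L1 _]]] [[z2 E2] [P2 [L2 _]]].
  exact (emden_unique a p y1 z1 y2 z2 Ha Hp E1 E2 P1 P2 L1 L2).
Qed.

Lemma emden_heteroclinic (a p : R) :
  1 / 2 < a < 1 -> 1 < p ->
  exists y, emden_orbit a p 0 (Rpower (a * (1 - a)) (1 / (p - 1))) y.
Proof.
  intros Ha Hp.
  destruct (exists_unstable a p ltac:(lra) Hp) as [y [z [E [Ly [Lz [T HT]]]]]].
  assert (P : forall t, 0 < y t)
    by (apply (emden_positive a p y z) with (T := T); trivial; lra).
  exists y. split; [now exists z|split; [exact P|split; [exact Ly|]]].
  replace (1 / (p - 1)) with (/ (p - 1)) by (field; lra).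
  now apply unstable_converges with (z := z).
Qed.

Lemma is_derive_Rpower_comp (f : R -> R) (t df r : R) :
  0 < f t -> is_derive f t df ->
  is_derive (fun t => Rpower (f t) r) t (r * Rpower (f t) (r - 1) * df).
Proof.
  intros Hf Df. evar_last.
  - apply (is_derive_comp (fun x => Rpower x r) f t (r * Rpower (f t) (r - 1)) df).
    + now apply is_derive_Reals, derivable_pt_lim_power.
    + exact Df.
  - change (df * (r * Rpower (f t) (r - 1)) = r * Rpower (f t) (r - 1) * df). ring.
Qed.

(* For [a = 1/2] the equation is conservative and the homoclinic orbit is
   explicit: [u(x) = x (1 + x^m / (m + 1))^(-1/m)] with [m = (p - 1) / 2]. *)
Lemma emden_homoclinic (p : R) :
  1 < p -> exists y, emden_orbit (1 / 2) p 0 0 y.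
Proof.
  intros Hp. set (m := (p - 1) / 2). assert (Hm : 0 < m) by (unfold m; lra).
  set (X := fun t => 1 + exp (m * t) / (m + 1)).
  assert (HX : forall t, 0 < exp (m * t) / (m + 1) /\ 1 < X t).
  { intros t. assert (0 < exp (m * t) / (m + 1))
      by (apply Rdiv_lt_0_compat; [apply exp_pos|lra]).
    unfold X. lra. }
  assert (DX : forall t, is_derive X t (m * (X t - 1))).
  { intros t. unfold X. auto_derive; [trivial|field; lra]. }
  set (h := fun t => Rpower (X t) (- / m)).
  set (Q := fun t => Rpower (X t) (- / m - 1)).
  assert (HhQ : forall t, h t = X t * Q t).
  { intros t. apply Rpower_split. destruct (HX t). lra. }
  assert (Hpos : forall t, 0 < h t) by (intro; apply Rpower_gt0).
  exists (fun t => exp ((1 - 1 / 2) * t) * h t).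
  split; [|split; [|split]].
  - eexists. apply emden_of_hQ with (Q := Q). intros t.
    assert (HXt : 0 < X t) by (destruct (HX t); lra). split.
    + rewrite HhQ. replace (Q t - X t * Q t) with
        (- / m * Q t * (m * (X t - 1))) by (field; lra).
      now apply (is_derive_Rpower_comp X).
    + replace ((p - 1) * (1 - 1 / 2)) with m by (unfold m; field).
      replace (- exp (m * t) * ppow p (h t)) with
        ((- / m - 1) * Rpower (X t) (- / m - 1 - 1) * (m * (X t - 1))).
      * now apply (is_derive_Rpower_comp X).
      * rewrite ppow_pos by apply Hpos. unfold h. rewrite Rpower_mult.
        replace (- / m * p) with (- / m - 1 - 1)
          by (replace p with (2 * m + 1) by (unfold m; field); field; lra).
        unfold X at 2. field. lra.
  - intros t. apply Rmult_lt_0_compat; [apply exp_pos|apply Hpos].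
  - apply is_lim_m_infty_squeeze0 with (g := fun t => exp (1 / 2 * t)) (T := 0).
    + intros t _. rewrite Rabs_pos_eq
        by (apply Rmult_le_pos; left; [apply exp_pos|apply Hpos]).
      assert (H1 : h t <= 1).
      { unfold h. destruct (HX t) as [_ H1].
        rewrite <- (Rpower_O (X t)) by lra.
        apply Rle_Rpower; [lra|].
        assert (0 < / m) by now apply Rinv_0_lt_compat. lra. }
      replace ((1 - 1 / 2) * t) with (1 / 2 * t) by field.
      assert (H2 := exp_pos (1 / 2 * t)). nra.
    + apply is_lim_exp_scal_m_infty. lra.
  (* The double negation moves the limit to -oo. There [X (- t) >= e^(- m t) / (m + 1)] gives
     [h (- t) <= K e^t], which beats the growth of [e^(- t / 2)]. *)
  - apply (is_lim_ext (fun t => exp ((1 - 1 / 2) * - - t) * h (- - t))).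
    { intros t. now rewrite Ropp_involutive. }
    apply (is_lim_opp_arg (fun t => exp ((1 - 1 / 2) * - t) * h (- t))).
    set (K := Rpower (m + 1) (/ m)).
    apply is_lim_m_infty_squeeze0 with
      (g := fun t => K * exp (1 / 2 * t)) (T := 0).
    + intros t _. rewrite Rabs_pos_eq
        by (apply Rmult_le_pos; left; [apply exp_pos|apply Hpos]).
      assert (H1 : h (- t) <= K * exp t).
      { unfold h. rewrite Rpower_Ropp.
        replace (K * exp t) with
          (/ Rpower (exp (m * - t) / (m + 1)) (/ m)).
        - destruct (HX (- t)) as [H1 H2].
          apply Rinv_le_contravar; [apply Rpower_gt0|].
          apply Rle_Rpower_l.
          + left. now apply Rinv_0_lt_compat.
          + unfold X. lra.
        - rewrite <- Rpower_Ropp. unfold Rpower at 1. unfold Rdiv.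
          rewrite ln_mult, ln_exp, ln_Rinv
            by (trivial; try apply exp_pos; try apply Rinv_0_lt_compat; lra).
          unfold K, Rpower. rewrite <- exp_plus. f_equal. field. lra. }
      replace (exp (1 / 2 * t)) with (exp ((1 - 1 / 2) * - t) * exp t)
        by (rewrite <- exp_plus; f_equal; field).
      assert (H2 := exp_pos ((1 - 1 / 2) * - t)). nra.
    + replace (Finite 0) with (Finite (K * 0)) by (f_equal; ring).
      apply is_lim_scal_l with (l := Finite 0).
      apply is_lim_exp_scal_m_infty. lra.
Qed.

(** * The change of variable [x = e^t] *)

Lemma filterlim_exp_at_right (f : R -> R) (l : R) :
  filterlim f (at_right 0) (locally l) <->
  is_lim (fun t => f (exp t)) m_infty l.
Proof.
  split; intros H.
  - apply (filterlim_comp R R R exp f (Rbar_locally m_infty) (at_right 0));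
      [|exact H].
    intros P [eps HP].
    destruct (proj1 (is_lim_m_infty_eps _ _) is_lim_exp_m eps (cond_pos eps))
      as [T HT].
    exists T. intros t Ht. apply HP; [apply HT, Ht|apply exp_pos].
  - apply filterlim_ext_loc with (f := fun x => f (exp (ln x))).
    { exists (mkposreal 1 Rlt_0_1). intros x _ Hx. now rewrite exp_ln. }
    apply (filterlim_comp R R R ln (fun t => f (exp t)) (at_right 0)
             (Rbar_locally m_infty)); [exact is_lim_ln_0|exact H].
Qed.

Lemma filterlim_exp_p_infty (f : R -> R) (l : R) :
  filterlim f (Rbar_locally p_infty) (locally l) <->
  is_lim (fun t => f (exp t)) p_infty l.
Proof.
  split; intros H.
  - apply (filterlim_comp R R R exp f (Rbar_locally p_infty)
             (Rbar_locally p_infty)); [exact is_lim_exp_p|exact H].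
  - apply filterlim_ext_loc with (f := fun x => f (exp (ln x))).
    { exists 0. intros x Hx. now rewrite exp_ln. }
    apply (filterlim_comp R R R ln (fun t => f (exp t)) (Rbar_locally p_infty)
             (Rbar_locally p_infty)); [exact is_lim_ln_p|exact H].
Qed.

Section Transfer.

Variables (sigma p : R).
Hypotheses (hs : sigma < -2) (hp : p > -1 - sigma).
Let a : R := expo_a sigma p.

Lemma expo_a_eq : sigma + 2 = a * (1 - p).
Proof. unfold a, expo_a. field. lra. Qed.

(** With [1 - p < 0], the bound [a > 0] is [sigma + 2 < 0], and [a < 1] is [1 - p < sigma + 2], a
    rewriting of [hp]. *)
Lemma expo_a_bounds : 0 < a < 1.
Proof. assert (H := expo_a_eq). nra. Qed.

Lemma c_a_pos : 0 < c_a sigma p.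
Proof. apply Rpower_gt0. Qed.

Lemma Rpower_exp (t q : R) : Rpower (exp t) q = exp (q * t).
Proof. unfold Rpower. now rewrite ln_exp. Qed.

Lemma asym_iff (u : R -> R) (l0 linf : R) :
  asym sigma p u l0 linf <->
  is_lim (fun t => exp (- a * t) * u (exp t)) m_infty (c_a sigma p * l0) /\
  is_lim (fun t => exp (- a * t) * u (exp t)) p_infty (c_a sigma p * linf).
Proof.
  assert (Hc := c_a_pos). unfold asym.
  rewrite filterlim_exp_at_right, filterlim_exp_p_infty.
  assert (E : forall t, u (exp t) / u_a sigma p (exp t)
              = / c_a sigma p * (exp (- a * t) * u (exp t))).
  { intros t. unfold u_a. rewrite Rpower_exp. fold a.
    replace (- a * t) with (- (a * t)) by ring. rewrite exp_Ropp.
    assert (H := exp_pos (a * t)). field. lra. }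
  assert (W : forall x l, is_lim (fun t => u (exp t) / u_a sigma p (exp t)) x
     (Finite l) <->
     is_lim (fun t => exp (- a * t) * u (exp t)) x (c_a sigma p * l)).
  { intros x l. split; intros H.
    - apply is_lim_ext with (f := fun t =>
        c_a sigma p * (u (exp t) / u_a sigma p (exp t))).
      + intros t. rewrite E. field. lra.
      + now apply is_lim_scal_l with (l := Finite l).
    - apply is_lim_ext with (f := fun t =>
        / c_a sigma p * (exp (- a * t) * u (exp t))).
      + intros t. now rewrite E.
      + replace l with (/ c_a sigma p * (c_a sigma p * l)) by (field; lra).
        now apply is_lim_scal_l with (l := Finite (c_a sigma p * l)). }
  now rewrite !W.
Qed.

Lemma emden_orbit_of_sol (u : R -> R) (l0 linf : R) :
  pos_C2_sol sigma p u /\ asym sigma p u l0 linf ->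
  emden_orbit a p (c_a sigma p * l0) (c_a sigma p * linf)
    (fun t => exp (- a * t) * u (exp t)).
Proof.
  intros [[Hpos [u1 [u2 Hu]]] Has]. apply asym_iff in Has.
  split; [|split; [|exact Has]].
  - exists (fun t => exp ((1 - a) * t) * u1 (exp t)
                     - a * (exp (- a * t) * u (exp t))).
    intros t. destruct (Hu (exp t) (exp_pos t)) as [D1 [D2 [_ E]]].
    assert (Hexp : exp (- a * t) * exp t = exp ((1 - a) * t))
      by (rewrite <- exp_plus; f_equal; ring).
    assert (Dy : is_derive (fun t => exp (- a * t) * u (exp t)) t
      (exp ((1 - a) * t) * u1 (exp t) - a * (exp (- a * t) * u (exp t)))).
    { auto_derive; [eexists; exact D1|].
      change (fun x => u x) with u. rewrite (is_derive_unique _ _ _ D1).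
      rewrite <- Hexp. ring. }
    split; [exact Dy|].
    evar_last.
    + apply (is_derive_minus (fun t => exp ((1 - a) * t) * u1 (exp t))
               (fun t => a * (exp (- a * t) * u (exp t)))).
      * assert (D3 : is_derive (fun t => exp ((1 - a) * t) * u1 (exp t)) t
          ((1 - a) * (exp ((1 - a) * t) * u1 (exp t))
           + exp ((1 - a) * t) * exp t * u2 (exp t))).
        { auto_derive; [eexists; exact D2|].
          change (fun x => u1 x) with u1. rewrite (is_derive_unique _ _ _ D2).
          ring. }
        exact D3.
      * apply (is_derive_scal (fun t => exp (- a * t) * u (exp t))). exact Dy.
    + unfold minus, opp. change plus with Rplus. simpl.
      replace (u2 (exp t)) with (- (Rpower (exp t) sigma * Rpower (u (exp t)) p))
        by lra.
      rewrite ppow_mult_exp, ppow_pos by apply Hpos, exp_pos.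
      rewrite Rpower_exp.
      (* The powers of [e^t] match because [sigma + 2 = a (1 - p)], the identity that makes the
         equation autonomous. *)
      replace (exp (p * (- a * t))) with
        (exp ((1 - a) * t) * exp t * exp (sigma * t)).
      * ring.
      * rewrite <- !exp_plus. f_equal.
        assert (H := expo_a_eq).
        replace sigma with (a * (1 - p) - 2) by lra. ring.
  - intros t. apply Rmult_lt_0_compat; [apply exp_pos|apply Hpos, exp_pos].
Qed.

Lemma sol_of_emden_orbit (y : R -> R) (l0 linf : R) :
  emden_orbit a p (c_a sigma p * l0) (c_a sigma p * linf) y ->
  pos_C2_sol sigma p (fun x => Rpower x a * y (ln x)) /\
  asym sigma p (fun x => Rpower x a * y (ln x)) l0 linf.
Proof.
  intros [[z E] [P L]].
  assert (Dln : forall x, 0 < x -> is_derive ln x (/ x))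
    by (intros; now apply is_derive_Reals, derivable_pt_lim_ln).
  assert (Dpow : forall r x, 0 < x ->
            is_derive (fun x => Rpower x r) x (r * Rpower x (r - 1)))
    by (intros; now apply is_derive_Reals, derivable_pt_lim_power).
  (* On [x^r f(ln x)] the operator [x d/dx] acts as [r + d/dt] on [f]; two applications give [u']
     and [u'']. *)
  assert (Dpy : forall r f df x, 0 < x -> is_derive f (ln x) df ->
    is_derive (fun x => Rpower x r * f (ln x)) x
      (Rpower x (r - 1) * (r * f (ln x) + df))).
  { intros r f df x Hx Df. evar_last.
    - apply (is_derive_mult (fun x => Rpower x r) (fun x => f (ln x)) x _ _
        (Dpow r x Hx) (is_derive_comp f ln x _ _ Df (Dln x Hx))).
      intros; apply Rmult_comm.
    - change plus with Rplus. change mult with Rmult. change scal with Rmult.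
      cbv beta. rewrite (Rpower_split x r) by exact Hx. field. lra. }
  split.
  - split.
    { intros x Hx. apply Rmult_lt_0_compat; [apply Rpower_gt0|apply P]. }
    (* In [u''] the linear terms cancel: [(a - 1)(a y + z) + a z + (1 - 2 a) z + a (1 - a) y = 0],
       which leaves [- x^(a-2) y^p]. *)
    exists (fun x => Rpower x (a - 1) * (a * y (ln x) + z (ln x))),
      (fun x => - (Rpower x (a - 1 - 1) * ppow p (y (ln x)))).
    intros x Hx. destruct (E (ln x)) as [Dy Dz]. split; [|split; [|split]].
    + now apply Dpy.
    + evar_last.
      * apply (Dpy (a - 1) (fun t => a * y t + z t)
          (a * z (ln x) + ((1 - 2 * a) * z (ln x) + a * (1 - a) * y (ln x)
             - ppow p (y (ln x)))) x Hx).
        apply (is_derive_plus (fun t => a * y t) z); [|exact Dz].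
        now apply (is_derive_scal y).
      * ring.
    + apply (continuous_opp (fun x => Rpower x (a - 1 - 1) * ppow p (y (ln x)))).
      apply (continuous_mult (fun x => Rpower x (a - 1 - 1))
               (fun x => ppow p (y (ln x)))).
      * apply (is_derive_continuous _ _ _ (Dpow _ x Hx)).
      * apply (continuous_comp (fun x => y (ln x)) (ppow p)).
        -- apply (continuous_comp ln y).
           ++ apply (is_derive_continuous _ _ _ (Dln x Hx)).
           ++ apply (is_derive_continuous _ _ _ Dy).
        -- apply continuous_ppow. lra.
    + rewrite ppow_pos by apply P.
      rewrite <- Rpower_mult_distr by (apply Rpower_gt0 || apply P).
      rewrite Rpower_mult, <- Rmult_assoc, <- Rpower_plus.
      replace (sigma + a * p) with (a - 1 - 1)
        by (assert (H := expo_a_eq); lra).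
      ring.
  - apply asym_iff.
    assert (Ey : forall t, exp (- a * t) * (Rpower (exp t) a * y (ln (exp t))) = y t).
    { intros t. rewrite Rpower_exp, ln_exp, <- Rmult_assoc, <- exp_plus.
      replace (- a * t + a * t) with 0 by ring. rewrite exp_0. ring. }
    destruct L as [L0 Linf].
    split; apply is_lim_ext with (f := y); trivial; intros; now rewrite Ey.
Qed.

Lemma exists_unique_of_emden (l0 linf : R) :
  (exists y, emden_orbit a p (c_a sigma p * l0) (c_a sigma p * linf) y) ->
  (forall y1 y2, emden_orbit a p (c_a sigma p * l0) (c_a sigma p * linf) y1 ->
     emden_orbit a p (c_a sigma p * l0) (c_a sigma p * linf) y2 ->
     exists tau, forall t, y2 t = y1 (t + tau)) ->
  exists_unique_up_to_scaling a
    (fun u => pos_C2_sol sigma p u /\ asym sigma p u l0 linf).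
Proof.
  intros [y Hy] Huniq. split.
  { eexists. now apply sol_of_emden_orbit with (y := y). }
  intros u v Hu Hv.
  destruct (Huniq _ _ (emden_orbit_of_sol u l0 linf Hu)
              (emden_orbit_of_sol v l0 linf Hv)) as [tau Ht].
  exists (exp tau). split; [apply exp_pos|]. intros x Hx.
  specialize (Ht (ln x)).
  rewrite exp_plus, exp_ln in Ht by exact Hx.
  rewrite Rpower_exp, (Rmult_comm (exp tau)).
  replace (- a * (ln x + tau)) with (- a * ln x + - a * tau) in Ht by ring.
  rewrite exp_plus, Rmult_assoc in Ht.
  apply Rmult_eq_reg_l with (1 := Ht).
  assert (H := exp_pos (- a * ln x)). lra.
Qed.

End Transfer.

Theorem theorem5p2 (sigma p : R) (hs : sigma < -2) (hp : p > -1 - sigma) :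
  (expo_a sigma p > 1/2 ->
     exists_unique_up_to_scaling (expo_a sigma p)
       (fun u => pos_C2_sol sigma p u /\ asym sigma p u 0 1)) /\
  (expo_a sigma p = 1/2 ->
     exists_unique_up_to_scaling (expo_a sigma p)
       (fun u => pos_C2_sol sigma p u /\ asym sigma p u 0 0)) /\
  (expo_a sigma p < 1/2 ->
     exists_unique_up_to_scaling (expo_a sigma p)
       (fun u => pos_C2_sol sigma p u /\ asym sigma p u 1 0)).
Proof.
  assert (Ha := expo_a_bounds sigma p hs hp). assert (Hp : 1 < p) by lra.
  assert (Ec : c_a sigma p =
    Rpower (expo_a sigma p * (1 - expo_a sigma p)) (1 / (p - 1))) by reflexivity.
  split; [|split]; intros H;
    (apply exists_unique_of_emden; [exact hs|exact hp| |]);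
    rewrite ?Rmult_0_r, ?Rmult_1_r.
  - rewrite Ec. apply emden_heteroclinic; lra.
  - intros y1 y2. now apply emden_orbit_unique.
  - rewrite H. now apply emden_homoclinic.
  - intros y1 y2. now apply emden_orbit_unique.
  - set (a := expo_a sigma p) in *.
    (* The constant [c_a] depends on [a] only through [a (1 - a)], so the orbit for [1 - a] has the
       right limit after reversal. *)
    destruct (emden_heteroclinic (1 - a) p ltac:(lra) Hp) as [y Hy].
    apply emden_orbit_reverse in Hy.
    replace (1 - (1 - a)) with a in Hy by ring.
    rewrite (Rmult_comm (1 - a)) in Hy. rewrite Ec. eexists. exact Hy.
  - intros y1 y2 H1 H2.
    apply emden_orbit_reverse in H1. apply emden_orbit_reverse in H2.
    destruct (emden_orbit_unique (1 - expo_a sigma p) p _ _ _ ltac:(lra) Hp H1 H2)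
      as [tau Ht].
    (* Time reversal changes the sign of the translation. *)
    exists (- tau). intros t. specialize (Ht (- t)). cbv beta in Ht.
    rewrite Ropp_involutive in Ht. rewrite Ht. f_equal. ring.
Qed.
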